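(* Let $(M,F)$ be an $n$-dimensional generalized isotropic Berwald manifold, i.e. a Finsler manifold for which there are smooth functions $\mu=\mu(x,y)$ and $\lambda=\lambda(x,y)$ on $TM_0$, homogeneous in $y$ of degrees $0$ and $-1$ respectively, with $$B^i_{\ jkl}=\mu\, C_{jkl}\,\ell^i+\lambda\,(h^i_j h_{kl}+h^i_k h_{jl}+h^i_l h_{jk}).$$ Suppose $F$ is of scalar flag curvature $K=K(x,y)$. Then $$\frac{n+1}{3}\,\frac{\partial K}{\partial y^k}+\Big(K+\frac{\mu^2}{4}-\frac{\mu'}{2F}\Big)I_k=0,$$ where $\mu'=\mu_{|s}y^s$.
   Context: $M$ is an $n$-dimensional $C^\infty$ manifold and $TM_0=TM\setminus\{0\}$ is the slit tangent bundle, with standard local coordinates $(x^i,y^i)$. A Finsler metric is a function $F:TM\to[0,\infty)$ that is $C^\infty$ on $TM_0$, positively $1$-homogeneous on the fibers, and such that $g_{ij}=\frac12\frac{\partial^2 F^2}{\partial y^i\partial y^j}$ is positive definite at every $y\in T_xM\setminus\{0\}$; write $\mathbf g_y(u,v)=g_{ij}(x,y)u^iv^j$. Indices are lowered and raised with $g_{ij}$ and its inverse $g^{ij}$. Homogeneity is positive homogeneity in $y$. Notation: $y_i=g_{ij}y^j$; $\ell^i=y^i/F$; $h_{ij}=g_{ij}-F^{-2}y_iy_j$, $h^i_j=\delta^i_j-F^{-2}y^iy_j$; Cartan torsion $C_{ijk}=\frac12\frac{\partial g_{ij}}{\partial y^k}$; mean Cartan torsion $I_k=g^{ij}C_{ijk}$;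 spray coefficients $G^i=\frac14 g^{il}\{\frac{\partial^2F^2}{\partial x^k\partial y^l}y^k-\frac{\partial F^2}{\partial x^l}\}$; Berwald curvature $B^i_{\ jkl}=\frac{\partial^3G^i}{\partial y^j\partial y^k\partial y^l}$. ''$|$'' denotes the horizontal covariant derivative of the Berwald connection; on a function $f$ on $TM_0$, $f_{|s}=\frac{\partial f}{\partial x^s}-\frac{\partial G^m}{\partial y^s}\frac{\partial f}{\partial y^m}$, so $\mu'=\mu_{|s}y^s=y^s\frac{\partial\mu}{\partial x^s}-2G^s\frac{\partial\mu}{\partial y^s}$. Riemann curvature: $R^i_{\ k}=2\frac{\partial G^i}{\partial x^k}-y^j\frac{\partial^2G^i}{\partial x^j\partial y^k}+2G^j\frac{\partial^2G^i}{\partial y^j\partial y^k}-\frac{\partial G^i}{\partial y^j}\frac{\partial G^j}{\partial y^k}$, $\mathbf R_y(u)=R^i_{\ k}u^k\frac{\partial}{\partial x^i}$. For a flag $P=\mathrm{span}\{y,u\}\subset T_xM$ with flagpole $y$, the flag curvature is $K(P,y)=\frac{\mathbf g_y(u,\mathbf R_y(u))}{\mathbf g_y(y,y)\mathbf g_y(u,u)-\mathbf g_y(y,u)^2}$. $F$ is of scalar flag curvature if $K(P,y)=K(x,y)$ is independent of the flags $P$ with flagpole $y$; equivalently $R^i_{\ k}=KF^2h^i_k$. *)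

(* Defs.v *)
From HB Require Import structures.
From mathcomp Require Import all_boot all_order all_algebra.
From mathcomp Require Import all_classical all_reals all_analysis.

Set Implicit Arguments.
Unset Strict Implicit.
Unset Printing Implicit Defensive.

Import Order.TTheory GRing.Theory Num.Theory.
Import numFieldNormedType.Exports.
Local Open Scope classical_set_scope.
Local Open Scope ring_scope.

(* For finite-dimensional V and open D this is the usual recursive definition:
   f is C^(k+1) iff f is differentiable and Df is C^k. *)
Fixpoint Ck (R : realType) (V W : normedModType R) (k : nat) (D : set V)
    (f : V -> W) : Prop :=
  match k with
  | 0 => forall x, D x -> {for x, continuous f}
  | k'.+1 => (forall x, D x -> differentiable f x) /\
             (forall v, Ck k' D (fun x => 'D_v f x))
  end.

Definition smooth_on (R : realType) (V W : normedModType R) (D : set V)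
    (f : V -> W) : Prop := forall k, Ck k D f.

(* A C^oo manifold given by an atlas, not required to be maximal. chart_map a
   and chart_inv a are total functions; their values outside chart_dom a and
   chart_map a @` chart_dom a respectively are irrelevant. *)
Record smooth_manifold (R : realType) (n : nat) := SmoothManifold {
  point_of :> topologicalType;
  manifold_hausdorff : hausdorff_space point_of;
  manifold_second_countable : @second_countable point_of;
  atlas : Type;
  chart_dom : atlas -> set point_of;
  chart_map : atlas -> point_of -> 'rV[R]_n;
  chart_inv : atlas -> 'rV[R]_n -> point_of;
  chart_dom_open : forall a, open (chart_dom a);
  chart_dom_cover : \bigcup_a chart_dom a = [set: point_of];
  chart_image_open : forall a, open (chart_map a @` chart_dom a);
  chart_mapK : forall a q, chart_dom a q -> chart_inv a (chart_map a q) = q;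
  chart_map_continuous :
    forall a, {within chart_dom a, continuous (chart_map a)};
  chart_inv_continuous :
    forall a, {within chart_map a @` chart_dom a, continuous (chart_inv a)};
  transition_smooth : forall a b,
    smooth_on (chart_map a @` (chart_dom a `&` chart_dom b))
      (chart_map b \o chart_inv a) }.

Arguments chart_dom {R n s} a _.
Arguments chart_map {R n s} a _.
Arguments chart_inv {R n s} a _.

Definition chart_image (R : realType) (n : nat) (M : smooth_manifold R n)
    (a : atlas M) : set 'rV[R]_n := chart_map a @` chart_dom a.

Definition transition (R : realType) (n : nat) (M : smooth_manifold R n)
    (a b : atlas M) : 'rV[R]_n -> 'rV[R]_n := chart_map b \o chart_inv a.

(* A tangent vector at q is the family of its component vectors in all charts
   around q, related by the differentials of the transition maps; components
   in the other charts are set to 0 so that equality is the right one. *)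
Record tangent (R : realType) (n : nat) (M : smooth_manifold R n) (q : M) :=
  Tangent {
    components :> atlas M -> 'rV[R]_n;
    components_transition : forall a b, chart_dom a q -> chart_dom b q ->
      components b = 'd (transition a b) (chart_map a q) (components a);
    components_out : forall a, ~ chart_dom a q -> components a = 0 }.

Definition tangent_bundle (R : realType) (n : nat) (M : smooth_manifold R n) :=
  {q : M & tangent q}.

Section Coordinates.
Variables (R : realType) (n : nat) (M : smooth_manifold R n).
Implicit Types (a b c : atlas M) (x y : 'rV[R]_n) (q : M).

Fact chart_inv_dom a x : chart_image a x -> chart_dom a (chart_inv a x).
Proof. by move=> [q aq <-]; rewrite chart_mapK. Qed.

Fact chart_invK a x : chart_image a x -> chart_map a (chart_inv a x) = x.
Proof. by move=> [q aq <-]; rewrite chart_mapK. Qed.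

Fact differentiable_transition a b x :
  chart_image a x -> chart_dom b (chart_inv a x) ->
  differentiable (transition a b) x.
Proof.
move=> ax bx; have [+ _] := @transition_smooth _ _ M a b 1.
apply; exists (chart_inv a x); last exact: chart_invK.
by split => //; exact: chart_inv_dom.
Qed.

Fact near_overlap a b x : chart_image a x -> chart_dom b (chart_inv a x) ->
  \forall z \near x, chart_dom b (chart_inv a z).
Proof.
move=> ax bx; have := @chart_inv_continuous _ _ M a.
rewrite continuous_open_subspace; last exact: chart_image_open.
move=> /(_ x (mem_set ax)) /=; apply.
by apply: open_nbhs_nbhs; split => //; exact: chart_dom_open.
Qed.

Fact transition_cocycle a b c x y : chart_image a x ->
  chart_dom b (chart_inv a x) -> chart_dom c (chart_inv a x) ->
  'd (transition b c) (transition a b x) ('d (transition a b) x y) =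
  'd (transition a c) x y.
Proof.
move=> ax bx cx.
have bI : chart_image b (transition a b x) by exists (chart_inv a x).
have E : chart_inv b (transition a b x) = chart_inv a x.
  by rewrite /transition /= chart_mapK.
have dab := differentiable_transition ax bx.
have dbc : differentiable (transition b c) (transition a b x).
  by apply: differentiable_transition; rewrite ?E.
have dac := differentiable_transition ax cx.
apply: esym; apply: etrans (esym (deriveE y dac)) _.
transitivity ('D_y (transition b c \o transition a b) x).
  apply: near_eq_derive; near=> z.
  rewrite /transition /= chart_mapK//.
  by near: z; exact: near_overlap.
apply: etrans (deriveE y (differentiable_comp dab dbc)) _.
exact: (congr1 (fun h : _ -> _ => h y) (diff_comp dab dbc)).
Unshelve. all: by end_near. Qed.

(* The coordinates (x, y) on the tangent bundle induced by the chart a: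
   tangent_at a (x, y) is the vector y^i d/dx^i at the point of coordinates x.
   It is meaningful for x in chart_image a only. *)
Definition tangent_at_components a (p : 'rV[R]_n * 'rV[R]_n) b : 'rV[R]_n :=
  if `[< chart_image a p.1 /\ chart_dom b (chart_inv a p.1) >]
  then 'd (transition a b) (p.1) p.2 else 0.

Fact tangent_at_transition a p b c :
  chart_dom b (chart_inv a p.1) -> chart_dom c (chart_inv a p.1) ->
  tangent_at_components a p c =
  'd (transition b c) (chart_map b (chart_inv a p.1))
    (tangent_at_components a p b).
Proof.
move=> bp cp; rewrite /tangent_at_components.
case: asboolP => [[ap _]|nc]; case: asboolP => [[ap' _]|nb].
- exact: esym (transition_cocycle p.2 ap bp cp).
- by case: nb.
- by case: nc.
- exact: esym (linear0 _).
Qed.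

Fact tangent_at_out a p b :
  ~ chart_dom b (chart_inv a p.1) -> tangent_at_components a p b = 0.
Proof.
by move=> nb; rewrite /tangent_at_components asboolF//; case.
Qed.

Definition tangent_at a (p : 'rV[R]_n * 'rV[R]_n) : tangent_bundle M :=
  existT _ (chart_inv a p.1)
    (Tangent (@tangent_at_transition a p) (@tangent_at_out a p)).

Fact tangent_at_coords a (v : tangent_bundle M) : chart_dom a (projT1 v) ->
  tangent_at a (chart_map a (projT1 v), projT2 v a) = v.
Proof.
case: v => q v /= aq.
have ext q' (e : q' = q) (u : tangent q') :
    u =1 v :> (atlas M -> _) -> existT (@tangent R n M) q' u = existT _ q v.
  subst q' => uv; congr existT; case: u v uv => [u u1 u2] [v v1 v2] /= uv.
  have {}uv : u = v by exact/funext.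
  by subst v; congr Tangent; exact: Prop_irrelevance.
apply: (ext _ (chart_mapK aq)) => b /=.
rewrite /tangent_at_components /= chart_mapK//.
have [bq|nbq] := pselect (chart_dom b q); last first.
  by rewrite asboolF ?components_out//; case.
rewrite asboolT; first by rewrite -components_transition.
by split => //; exists q.
Qed.

Fact tangent_at_components_id a x y : chart_image a x ->
  projT2 (tangent_at a (x, y)) a = y.
Proof.
move=> ax; rewrite /= /tangent_at_components /= asboolT; last first.
  by split => //; exact: chart_inv_dom.
have aax := chart_inv_dom ax.
apply: etrans (esym (deriveE y (differentiable_transition ax aax))) _.
apply: etrans _ (derive_id x y); apply: near_eq_derive.
near=> z; rewrite /transition /= chart_invK//; near: z.
by apply: open_nbhs_nbhs; split => //; exact: chart_image_open.
Unshelve. all: by end_near. Qed.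

Definition local_rep (f : tangent_bundle M -> R) a
    (p : 'rV[R]_n * 'rV[R]_n) : R := f (tangent_at a p).

Definition slit_chart a : set ('rV[R]_n * 'rV[R]_n) :=
  [set p | chart_image a p.1 /\ p.2 != 0].

Definition smooth_on_slit (f : tangent_bundle M -> R) : Prop :=
  forall a, smooth_on (slit_chart a) (local_rep f a).

Definition homogeneous_on_slit (r : int) (f : tangent_bundle M -> R) : Prop :=
  forall a x y (t : R), slit_chart a (x, y) -> 0 < t ->
    local_rep f a (x, t *: y) = t ^ r * local_rep f a (x, y).

End Coordinates.

(* Tensors in local coordinates (x, y), computed from the local expression F of
   the metric. *)
Section LocalTensors.
Variables (R : realType) (n : nat).
Implicit Types (F f : 'rV[R]_n * 'rV[R]_n -> R) (p : 'rV[R]_n * 'rV[R]_n).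
Implicit Types (i j k l s m : 'I_n) (u v : 'rV[R]_n).

Definition partial_x i f p : R := 'D_(delta_mx 0 i, 0) f p.
Definition partial_y i f p : R := 'D_(0, delta_mx 0 i) f p.

Definition square F p : R := F p ^+ 2.

Definition fund_tensor F p : 'M[R]_n :=
  \matrix_(i, j) (2^-1 * partial_y i (partial_y j (square F)) p).

Definition inv_fund_tensor F p : 'M[R]_n := invmx (fund_tensor F p).

Definition fund_product F p u v : R :=
  \sum_i \sum_j fund_tensor F p i j * u 0 i * v 0 j.

Definition y_low F i p : R := \sum_j fund_tensor F p i j * p.2 0 j.

Definition ell F i p : R := p.2 0 i / F p.

Definition angular_low F i j p : R :=
  fund_tensor F p i j - (F p) ^- 2 * y_low F i p * y_low F j p.

Definition angular_mixed F i j p : R :=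
  (i == j)%:R - (F p) ^- 2 * p.2 0 i * y_low F j p.

Definition cartan F i j k p : R :=
  2^-1 * partial_y k (fun q => fund_tensor F q i j) p.

Definition mean_cartan F k p : R :=
  \sum_i \sum_j inv_fund_tensor F p i j * cartan F i j k p.

Definition spray F i p : R :=
  4^-1 * \sum_l inv_fund_tensor F p i l *
    ((\sum_k partial_x k (partial_y l (square F)) p * p.2 0 k)
     - partial_x l (square F) p).

Definition berwald F i j k l p : R :=
  partial_y j (partial_y k (partial_y l (spray F i))) p.

Definition hderiv F s f p : R :=
  partial_x s f p - \sum_m partial_y s (spray F m) p * partial_y m f p.

Definition hderiv_along F f p : R := \sum_s hderiv F s f p * p.2 0 s.

Definition riemann F i k p : R :=
  2 * partial_x k (spray F i) p
  - \sum_j p.2 0 j * partial_x j (partial_y k (spray F i)) p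
  + 2 * \sum_j spray F j p * partial_y j (partial_y k (spray F i)) p
  - \sum_j partial_y j (spray F i) p * partial_y k (spray F j) p.

Definition riemann_map F p u : 'rV[R]_n :=
  \row_i \sum_k riemann F i k p * u 0 k.

Definition flag_curvature F p u : R :=
  fund_product F p u (riemann_map F p u) /
  (fund_product F p p.2 p.2 * fund_product F p u u
   - fund_product F p p.2 u ^+ 2).

End LocalTensors.

Section Finsler.
Variables (R : realType) (n : nat) (M : smooth_manifold R n).
Implicit Types (F f K mu lambda : tangent_bundle M -> R).

Record finsler_metric F : Prop := FinslerMetric {
  finsler_ge0 : forall v, 0 <= F v;
  finsler_smooth : smooth_on_slit F;
  finsler_homogeneous : forall (a : atlas M) x y (t : R),
    chart_image a x -> 0 < t ->
    local_rep F a (x, t *: y) = t * local_rep F a (x, y);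
  finsler_posdef : forall (a : atlas M) p u, slit_chart a p -> u != 0 ->
    0 < fund_product (local_rep F a) p u u }.

(* mu and lambda are functions on the slit tangent bundle: their values on the
   zero section are irrelevant. *)
Record generalized_isotropic_berwald F mu lambda : Prop :=
    GeneralizedIsotropicBerwald {
  gib_smooth_mu : smooth_on_slit mu;
  gib_smooth_lambda : smooth_on_slit lambda;
  gib_homogeneous_mu : homogeneous_on_slit 0 mu;
  gib_homogeneous_lambda : homogeneous_on_slit (-1) lambda;
  gib_berwald : forall (a : atlas M) p, slit_chart a p ->
    forall i j k l, let Fa := local_rep F a in
    berwald Fa i j k l p =
      local_rep mu a p * cartan Fa j k l p * ell Fa i p
      + local_rep lambda a p *
          (angular_mixed Fa i j p * angular_low Fa k l p
           + angular_mixed Fa i k p * angular_low Fa j l p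
           + angular_mixed Fa i l p * angular_low Fa j k p) }.

(* The flag curvature of every flag span{y, u} with flagpole y is K(x, y). *)
Definition scalar_flag_curvature F K : Prop :=
  forall (a : atlas M) p u, slit_chart a p -> free [:: p.2; u] ->
    flag_curvature (local_rep F a) p u = local_rep K a p.

End Finsler.

(* Main.v *)
Require Import Defs.
From HB Require Import structures.
From mathcomp Require Import all_boot all_order all_algebra.
From mathcomp Require Import all_classical all_reals all_analysis.
From mathcomp Require Import ring lra.

Set Implicit Arguments.
Unset Strict Implicit.
Unset Printing Implicit Defensive.

Import Order.TTheory GRing.Theory Num.Theory.
Import numFieldNormedType.Exports.
Local Open Scope classical_set_scope.
Local Open Scope ring_scope.

(** Differentiating the spray equation gives two facts about a Finsler metric.
    Write [X] for the spray as a vector field on the slit tangent bundle, [E] for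
    the square of the metric, [D] for the covariant derivative along [X], and
    subscripts for derivatives in the fibre.

    First, [X E_l = dE/dx^l] and [X E = 0]. Differentiating these in [y] shows
    that the covariant derivative along [X] of [E_jkl], which is four times the
    Cartan torsion, is [- E_s B^s_jkl] (spray_cov_third). Second, the Riemann
    curvature is built from [dG/dx], [X N] and [N N], where [N = dG/dy]. In the cyclic sum of its
    second fibre derivatives the [x]-derivatives and the products of second
    derivatives of [G] cancel, leaving [-3 D B] (riem_cyclic).

    For a generalized isotropic Berwald metric, the [lambda]-part of [B] is
    killed by [y_s], so [E_s B^s_jkl = psi E_jkl] with [psi = mu F / 2]
    (landsberg_isotropic). Differentiating once more along [X] gives
    [(X psi - psi ^ 2) E_jkl] for the left-hand side of the second fact, while
    scalar flag curvature [R^i_k = K F^2 h^i_k] makes its right-hand side explicit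
    in [K] and [dK/dy]. The outcome is third_derivative_scalar, whose trace in
    two of the three indices is the theorem, since [X F = 0]
    and [X mu = mu'].

    Two points need care. The flag curvature determines only the quadratic form
    [g(u, R u)], so recovering [R] requires the self-adjointness of the Riemann
    curvature (riem_low_sym) and an extension from the vectors
    independent of [y] to all vectors (form_eq0_of_free). Also, [K] is an arbitrary function; it is smooth because
    it is a quotient of the trace of [R] (flag_curvature_smooth).

    The smooth functions on an open set form a commutative ring on which
    directional derivatives are commuting derivations. All the tensor calculus is
    done in an abstract ring with such derivations; the relation [represents]
    transports the coordinate expressions of the tensors into that ring. *)

(** * Closure properties of C^k functions *)

Section Smooth.
Variables (R : realType) (V : normedModType R).
Implicit Types (f g : V -> R) (u v x : V) (D : set V) (k : nat).

(** Both functions have the same first order expansion at [x], so the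
    differential of [f] serves for [g]. *)
Lemma near_eq_differentiable f g x :
  (\forall z \near x, f z = g z) -> differentiable f x -> differentiable g x.
Proof.
move=> fg df.
have fgx : f x = g x by exact: nbhs_singleton fg.
have dfc : continuous ('d f x) by exact: diff_continuous.
have gE : g \o shift x = cst (g x) + 'd f x +o_ 0 id.
  apply/eqaddoP => e e0.
  have /diff_locally /eqaddoP /(_ e e0) := df.
  have : \forall h \near (0 : V), f (h + x) = g (h + x).
    move: fg; rewrite (near_shift 0 x) /= => fg.
    by apply: filterS fg => h; rewrite subr0.
  apply: filterS2 => h /= fgh.
  by rewrite !fctE /= fgh fgx.
by apply/diff_locallyP; rewrite (diff_unique dfc gE).
Qed.

(** A derivative at a point of [D] depends only on the values near that point,
    and these are taken in [D] because [D] is open. *)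
Lemma Ck_ext k D f g : open D -> {in D, f =1 g} -> Ck k D f -> Ck k D g.
Proof.
move=> Dop; elim: k f g => [|k IH] f g fg /=.
  move=> cf x Dx; have fgx : \forall z \near x, f z = g z.
    by apply: filterS (open_nbhs_nbhs (conj Dop Dx)) => z Dz; rewrite fg ?inE.
  rewrite /prop_for /continuous_at -(nbhs_singleton fgx).
  apply: cvg_trans (cf x Dx); apply: near_eq_cvg.
  exact: fgx.
have near_fg x : D x -> \forall z \near x, f z = g z.
  move=> Dx.
  by apply: filterS (open_nbhs_nbhs (conj Dop Dx)) => z Dz; rewrite fg ?inE.
move=> [df Df]; split=> [x Dx|v]; first exact: near_eq_differentiable (near_fg x Dx) (df x Dx).
apply: IH (Df v) => x; rewrite inE => Dx; exact: near_eq_derive (near_fg x Dx).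
Qed.

Lemma CkW k D f : Ck k.+1 D f -> Ck k D f.
Proof.
elim: k f => [|k IH] f [df Df]; last by split=> // v; exact: IH.
by move=> x Dx; exact: differentiable_continuous (df x Dx).
Qed.

Lemma Ck_cst k D (c : R) : Ck k D (fun=> c : R).
Proof.
elim: k c => [|k IH] c /=; first by move=> x _; exact: cst_continuous.
split=> [x _|v]; first exact: differentiable_cst.
have -> : (fun x => 'D_v (fun=> c) x) = (fun=> 0 : R).
  by apply/funext => x; rewrite derive_cst.
exact: IH.
Qed.

Lemma Ck_linear k D (f : {linear V -> R}) : continuous f -> Ck k D f.
Proof.
move=> cf; case: k => [|k] /=; first by move=> x _; exact: cf.
split=> [x _|v]; first exact: linear_differentiable.
have -> : (fun x => 'D_v f x) = (fun=> f v).
  apply/funext => x; rewrite deriveE ?diff_lin //.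
  exact: linear_differentiable.
exact: Ck_cst.
Qed.

Lemma CkD k D f g : open D -> Ck k D f -> Ck k D g -> Ck k D (fun x => f x + g x).
Proof.
move=> Dop; elim: k f g => [|k IH] f g /=.
  by move=> cf cg x Dx; apply: continuousD; [exact: cf|exact: cg].
move=> [df Df] [dg Dg]; split=> [x Dx|v].
  exact: differentiableD (df x Dx) (dg x Dx).
apply: Ck_ext Dop _ (IH _ _ (Df v) (Dg v)) => x; rewrite inE => Dx.
by rewrite -deriveD //; apply: diff_derivable; [exact: df|exact: dg].
Qed.

Lemma CkM k D f g : open D -> Ck k D f -> Ck k D g -> Ck k D (fun x => f x * g x).
Proof.
move=> Dop; elim: k f g => [|k IH] f g.
  by move=> cf cg x Dx; apply: continuousM; [exact: cf|exact: cg].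
move=> Cf Cg; have [df Df] := Cf; have [dg Dg] := Cg; split=> [x Dx|v].
  exact: differentiableM (df x Dx) (dg x Dx).
apply: Ck_ext Dop _ (CkD Dop (IH _ _ (CkW Cf) (Dg v)) (IH _ _ (CkW Cg) (Df v))).
move=> x; rewrite inE => Dx.
rewrite -[RHS]/('D_v (f * g) x) deriveM//; apply: diff_derivable; by [exact: df|exact: dg].
Qed.

Lemma CkV k D f : open D -> (forall x, D x -> f x != 0) ->
  Ck k D f -> Ck k D (fun x => (f x)^-1).
Proof.
move=> Dop f0; elim: k => [|k IH].
  by move=> cf x Dx; apply: continuousV; [exact: f0|exact: cf].
move=> Cf; have [df Df] := Cf; have {}IH := IH (CkW Cf); split=> [x Dx|v].
  exact: differentiableV (df x Dx) (f0 x Dx).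
have CN := CkM Dop (@Ck_cst k D (-1)) (CkM Dop (CkM Dop IH IH) (Df v)).
apply: Ck_ext Dop _ CN => x; rewrite inE => Dx.
rewrite deriveV ?f0//; last exact: diff_derivable (df x Dx).
by rewrite scaleNr mulN1r expr2 invfM.
Qed.

End Smooth.

(** * Symmetry of second derivatives *)

Section Schwarz.
Variables (R : realType) (V : normedModType R).
Implicit Types (f : V -> R) (u v x y : V) (D : set V).

(** The difference quotients on both sides are the same function of the
    increment. *)
Lemma is_derive_line f u y (s : R) : derivable f (s *: u + y) u ->
  is_derive s 1 (fun t => f (t *: u + y)) ('D_u f (s *: u + y)).
Proof.
have E : (fun h : R => h^-1 *: (f ((h *: 1 + s) *: u + y) - f (s *: u + y))) =
         (fun h : R => h^-1 *: (f (h *: u + (s *: u + y)) - f (s *: u + y))).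
  by apply/funext => h; rewrite [h%:A]mulr1 scalerDl addrA.
move=> df; apply: DeriveDef.
- by move: df; rewrite /derivable -E.
- by rewrite /derive -E.
Qed.

Lemma MVT_line f u y (h : R) : 0 < h ->
  (forall s, 0 <= s <= h -> derivable f (s *: u + y) u) ->
  exists2 s, 0 <= s <= h & f (h *: u + y) - f y = h * 'D_u f (s *: u + y).
Proof.
move=> h0 df.
have dg s : s \in `[0, h]%R ->
    is_derive s 1 (fun t => f (t *: u + y)) ('D_u f (s *: u + y)).
  by rewrite in_itv /= => sh; apply: is_derive_line; exact: df.
set g := fun t => f (t *: u + y) in dg.
have gc : {within `[0, h], continuous g}.
  by apply: derivable_within_continuous => s /dg [].
have gd s : s \in `]0, h[%R -> is_derive s 1 g ('D_u f (s *: u + y)).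
  by move=> /subset_itv_oo_cc /dg.
have [s sh E] := MVT_segment (ltW h0) gd gc.
exists s; first by rewrite in_itv in sh.
by rewrite mulrC -{2}[h]subr0 -E /g scale0r add0r.
Qed.

(** Applying the mean value theorem first in the direction [u], to the increment
    of [f] along [v], then in the direction [v]. Exchanging [u] and [v] leaves the
    left-hand side unchanged, hence Schwarz's theorem. *)
Lemma second_difference D f u v x (r h : R) : Ck 2 D f -> ball x r `<=` D ->
  0 < h -> h * (`|u| + `|v|) < r ->
  exists2 z, ball x r z &
    f (h *: u + (h *: v + x)) - f (h *: u + x) - (f (h *: v + x) - f x) =
    h ^+ 2 * 'D_v ('D_u f) z.
Proof.
move=> [df Df] xD h0 hr.
have inB (s t : R) : 0 <= s <= h -> 0 <= t <= h -> ball x r (s *: u + (t *: v + x)).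
  move=> /andP[s0 sh] /andP[t0 th].
  rewrite -ball_normE /= addrA opprD addrCA subrr addr0 normrN.
  apply: le_lt_trans (ler_normD _ _) _; apply: le_lt_trans hr.
  rewrite !normrZ (ger0_norm s0) (ger0_norm t0) mulrDr.
  by apply: lerD; apply: ler_wpM2r.
have hh : 0 <= h <= h by rewrite (ltW h0) lexx.
have h00 : 0 <= (0 : R) <= h by rewrite lexx ltW.
have [_ D2] := Df u.
pose g y := f (h *: v + y) - f y.
have dfin (s t : R) : 0 <= s <= h -> 0 <= t <= h ->
    differentiable f (s *: u + (t *: v + x)).
  by move=> sh th; apply/df/xD/inB.
have dgE (s : R) : 0 <= s <= h -> is_derive (s *: u + x) u g
    ('D_u f (s *: u + (h *: v + x)) - 'D_u f (s *: u + x)).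
  move=> sh.
  have H1 : is_derive (s *: u + x) u (fun y => f (h *: v + y))
      ('D_u f (s *: u + (h *: v + x))).
    have E : (fun k : R => k^-1 *: (f (h *: v + (k *: u + (s *: u + x))) -
        f (h *: v + (s *: u + x)))) =
      (fun k : R => k^-1 *: (f (k *: u + (s *: u + (h *: v + x))) -
        f (s *: u + (h *: v + x)))).
      apply/funext => k; congr (_ *: (f _ - f _)); last by rewrite addrCA.
      by rewrite addrCA (addrCA (h *: v)).
    have df' : derivable f (s *: u + (h *: v + x)) u.
      by apply: diff_derivable; exact: dfin.
    by apply: DeriveDef; [move: df'; rewrite /derivable -E | rewrite /derive -E].
  have H2 : is_derive (s *: u + x) u f ('D_u f (s *: u + x)).
    apply: derivableP; apply: diff_derivable.
    by have := dfin s 0 sh h00; rewrite scale0r add0r.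
  exact: is_deriveB.
have [s sh gE] : exists2 s, 0 <= s <= h & g (h *: u + x) - g x =
    h * 'D_u g (s *: u + x).
  by apply: MVT_line => // s /dgE [].
have [_ dg] := dgE s sh.
have [t th fE] : exists2 t, 0 <= t <= h &
    'D_u f (h *: v + (s *: u + x)) - 'D_u f (s *: u + x) =
    h * 'D_v ('D_u f) (t *: v + (s *: u + x)).
  apply: (@MVT_line ('D_u f) v _ h h0) => t th; apply: diff_derivable.
  have [+ _] := Df u; apply; apply: xD; rewrite addrCA; exact: inB.
exists (s *: u + (t *: v + x)); first exact: inB.
rewrite (addrCA (h *: u)); transitivity (g (h *: u + x) - g x); first by [].
apply: etrans gE _; apply: etrans (congr1 ( *%R h) dg) _.
rewrite (addrCA (s *: u)) fE mulrA expr2 (addrCA (t *: v)).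
reflexivity.
Qed.

Lemma derive_comm D f u v x : open D -> Ck 2 D f -> D x ->
  'D_u ('D_v f) x = 'D_v ('D_u f) x.
Proof.
have same_quotient (m a b c d p q : R) : m != 0 ->
    a - b - (c - d) = m * p -> a - c - (b - d) = m * q -> p = q.
  by move=> m0 ep eq; apply: (mulfI m0); rewrite -ep -eq; ring.
have close (e a b p q : R) : p = q ->
    `|a - q| < e / 2 -> `|b - p| < e / 2 -> `|a - b| <= e.
  move=> -> aq bq; rewrite (_ : a - b = (a - q) - (b - q)); last by ring.
  by apply: le_trans (ler_normB _ _) _; lra.
have dist_eq (a b : R) : (forall e, 0 < e -> `|a - b| <= e) -> a = b.
  move=> ab; apply/subr0_eq/eqP; rewrite -normr_le0.
  by apply/ler_addgt0Pl => e /ab; rewrite addr0.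
move=> Dop Cf Dx.
have [_ D1] := Cf.
have cuv : {for x, continuous ('D_u ('D_v f))}.
  exact: (D1 v).2 u x Dx.
have cvu : {for x, continuous ('D_v ('D_u f))}.
  exact: (D1 u).2 v x Dx.
apply: dist_eq => e e0.
have e20 : 0 < e / 2 by rewrite divr_gt0.
have : \forall z \near x, D z /\
   (`|'D_u ('D_v f) x - 'D_u ('D_v f) z| < e / 2 /\
    `|'D_v ('D_u f) x - 'D_v ('D_u f) z| < e / 2).
  apply: filterI; first exact: open_nbhs_nbhs.
  apply: filterI; [have /cvgrPdist_lt := cuv | have /cvgrPdist_lt := cvu]; exact.
move=> /nbhs_ballP [r /= r0 Br].
(* The step [h] is small enough for the parallelogram spanned by [h u] and
   [h v] at [x] to stay in the ball; [1] is added to avoid dividing by [0]. *)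
pose N := `|u| + `|v| + 1.
have N0 : 0 < N by rewrite ltr_wpDl// addr_ge0.
pose h := r / (2 * N).
have h0 : 0 < h by rewrite divr_gt0// mulr_gt0.
have hN : h * (2 * N) = r by rewrite divfK// gt_eqF// mulr_gt0.
have hr : h * (`|u| + `|v|) < r.
  rewrite -hN ltr_pM2l// /N; have := normr_ge0 u; have := normr_ge0 v; lra.
have BD : ball x r `<=` D by move=> z /Br [].
have [z1 /Br [_ [_ B1]] E1] := second_difference Cf BD h0 hr.
have hr' : h * (`|v| + `|u|) < r by rewrite addrC.
have [z2 /Br [_ [B2 _]] E2] := second_difference Cf BD h0 hr'.
rewrite (addrCA (h *: v)) in E2.
have h2 : h ^+ 2 != 0 by rewrite expf_neq0// gt_eqF.
exact: close (same_quotient _ _ _ _ _ _ _ h2 E1 E2) B2 B1.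
Qed.

End Schwarz.

(** * The ring of smooth functions on an open set *)

Section SmoothRing.
Variables (R : realType) (V : normedModType R) (D : set V).
Implicit Types (f g : V -> R) (u v x : V).

(** Functions are extended by zero outside [D], so that equality in the ring is
    equality of the values on [D]. The unit is then the indicator of [D], which
    is why the ring structure is not inherited from that of all functions. *)
Definition smooth_pred : {pred (V -> R)} :=
  fun f => `[< smooth_on D f /\ forall x, ~ D x -> f x = 0 >].

Record smooth_fun (Dop : open D) := SmoothFun {
  smooth_val :> V -> R;
  smooth_valP : smooth_val \in smooth_pred }.

Hypothesis Dop : open D.
Local Notation S := (smooth_fun Dop).
Implicit Types (phi psi : S).

HB.instance Definition _ := [isSub for @smooth_val Dop].
HB.instance Definition _ := [Choice of smooth_fun Dop by <:].

Lemma smooth_funP phi : smooth_on D phi.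
Proof. by case: phi => f /= /asboolP[]. Qed.

Lemma smooth_fun_out phi x : ~ D x -> phi x = 0.
Proof. by case: phi => f /= /asboolP[_]; apply. Qed.

Fact smooth_pred_zmod : zmod_closed smooth_pred.
Proof.
split=> [|f g /asboolP[Cf f0] /asboolP[Cg g0]]; apply/asboolP; split => [k|x nDx].
- exact: Ck_cst.
- by [].
- have CN := CkM Dop (@Ck_cst _ _ k D (-1)) (Cg k).
  apply: (Ck_ext Dop _ (CkD Dop (Cf k) CN)) => x _; rewrite mulN1r; reflexivity.
- by rewrite !fctE f0// g0// subr0.
Qed.

HB.instance Definition _ :=
  GRing.isZmodClosed.Build (V -> R) smooth_pred smooth_pred_zmod.
HB.instance Definition _ :=
  [SubChoice_isSubZmodule of smooth_fun Dop by <:].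

Definition on_domain f x : R := if `[< D x >] then f x else 0.

Lemma on_domainT f x : D x -> on_domain f x = f x.
Proof. by move=> Dx; rewrite /on_domain asboolT. Qed.

Fact on_domain_smooth f : smooth_on D f -> on_domain f \in smooth_pred.
Proof.
move=> Cf; apply/asboolP; split=> [k|x nDx]; last by rewrite /on_domain asboolF.
by apply: Ck_ext Dop _ (Cf k) => x; rewrite inE => /on_domainT ->.
Qed.

Definition to_smooth f (Cf : smooth_on D f) : S :=
  SmoothFun Dop (on_domain_smooth Cf).

Lemma to_smoothE f (Cf : smooth_on D f) x : D x -> to_smooth Cf x = f x.
Proof. exact: on_domainT. Qed.

Lemma smooth_fun_ext phi psi : (forall x, D x -> phi x = psi x) -> phi = psi.
Proof.
move=> H; apply: val_inj; apply/funext => x.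
have [/H //|nDx] := pselect (D x).
by rewrite /= !smooth_fun_out.
Qed.

Fact smooth_mulP phi psi : smooth_on D (fun x => phi x * psi x).
Proof. by move=> k; apply: CkM => //; exact: smooth_funP. Qed.

Definition smooth_mul phi psi : S := to_smooth (smooth_mulP phi psi).

Fact smooth_cstP (c : R) : smooth_on D (fun=> c).
Proof. by move=> k; exact: Ck_cst. Qed.

Definition smooth_cst c : S := to_smooth (smooth_cstP c).

Fact smooth_mulA : associative smooth_mul.
Proof.
move=> p q r; apply: smooth_fun_ext => x Dx.
by rewrite !to_smoothE// mulrA.
Qed.

Fact smooth_mulC : commutative smooth_mul.
Proof.
by move=> p q; apply: smooth_fun_ext => x Dx; rewrite !to_smoothE// mulrC.
Qed.

Fact smooth_mul1 : left_id (smooth_cst 1) smooth_mul.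
Proof.
by move=> p; apply: smooth_fun_ext => x Dx; rewrite !to_smoothE// mul1r.
Qed.

Fact smooth_mulD : left_distributive smooth_mul +%R.
Proof.
move=> p q r; apply: smooth_fun_ext => x Dx.
rewrite !to_smoothE//= -[LHS]/((p x + q x) * r x) mulrDl.
by rewrite -[RHS]/(smooth_mul p r x + smooth_mul q r x) !to_smoothE.
Qed.

HB.instance Definition _ := GRing.Zmodule_isComPzRing.Build (smooth_fun Dop)
  smooth_mulA smooth_mulC smooth_mul1 smooth_mulD.

Lemma smooth_funD phi psi x : (phi + psi) x = phi x + psi x.
Proof. by []. Qed.

Lemma smooth_funN phi x : (- phi) x = - phi x.
Proof. by []. Qed.

Lemma smooth_funM phi psi x : (phi * psi) x = phi x * psi x.
Proof.
have [Dx|nDx] := pselect (D x); first exact: to_smoothE.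
by rewrite !smooth_fun_out// mul0r.
Qed.

Definition smooth_eval x (Dx : D x) phi : R := phi x.

Section Eval.
Variables (x : V) (Dx : D x).

Fact smooth_eval_zmod : zmod_morphism (smooth_eval Dx).
Proof. by []. Qed.

Fact smooth_eval_monoid : monoid_morphism (smooth_eval Dx).
Proof.
split; first exact: (to_smoothE (smooth_cstP 1)).
by move=> p q; exact: smooth_funM.
Qed.

HB.instance Definition _ :=
  GRing.isZmodMorphism.Build (smooth_fun Dop) R (smooth_eval Dx) smooth_eval_zmod.
HB.instance Definition _ :=
  GRing.isMonoidMorphism.Build (smooth_fun Dop) R (smooth_eval Dx) smooth_eval_monoid.

End Eval.

(** This makes the inverse of the fundamental tensor, and the division by [F ^ 2],
    available inside the ring. *)
Lemma smooth_inverse phi :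
  (forall x, D x -> phi x != 0) -> exists psi, phi * psi = 1.
Proof.
move=> phi0; have Ci : smooth_on D (fun x => (phi x)^-1).
  by move=> k; apply: CkV => //; exact: smooth_funP.
exists (to_smooth Ci); apply: smooth_fun_ext => x Dx.
by rewrite smooth_funM (to_smoothE Ci Dx) mulfV ?phi0// (to_smoothE _ Dx).
Qed.

Fact derivation_smooth v phi : smooth_on D (fun x => 'D_v phi x).
Proof. by move=> k; have [_ ] := @smooth_funP phi k.+1; exact. Qed.

Definition derivation v phi : S := to_smooth (derivation_smooth v phi).

Lemma smooth_derivable phi v x : D x -> derivable phi x v.
Proof.
move=> Dx; have [+ _] := @smooth_funP phi 1.
by move=> /(_ x Dx); exact: diff_derivable.
Qed.

Lemma derivationE v phi x : D x -> derivation v phi x = 'D_v phi x.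
Proof. exact: to_smoothE. Qed.

Lemma derivationB v : zmod_morphism (derivation v).
Proof.
move=> p q; apply: smooth_fun_ext => x Dx.
rewrite smooth_funD smooth_funN !derivationE//.
by rewrite -deriveB//; exact: smooth_derivable.
Qed.

Lemma derivationM v phi psi :
  derivation v (phi * psi) = derivation v phi * psi + phi * derivation v psi.
Proof.
apply: smooth_fun_ext => x Dx.
rewrite smooth_funD !smooth_funM !derivationE//.
have -> : 'D_v (phi * psi) x = 'D_v ((phi : V -> R) * (psi : V -> R)) x.
  by congr ('D_v _ x); apply/funext => z; exact: smooth_funM.
rewrite deriveM; [|exact: smooth_derivable..].
by rewrite addrC mulrC.
Qed.

Lemma near_derive_ext f g v x :
  D x -> (forall z, D z -> f z = g z) -> 'D_v f x = 'D_v g x.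
Proof.
move=> Dx fg; apply: near_eq_derive.
by apply: filterS (open_nbhs_nbhs (conj Dop Dx)) => z /fg.
Qed.

Lemma derivationC u v phi :
  derivation u (derivation v phi) = derivation v (derivation u phi).
Proof.
apply: smooth_fun_ext => x Dx.
have iterE w z : derivation w (derivation z phi) x = 'D_w ('D_z phi) x.
  apply: etrans (derivationE _ _ Dx) _.
  by apply: near_derive_ext Dx _ => t; exact: derivationE.
apply: etrans (iterE u v) _; apply: etrans _ (esym (iterE v u)).
exact: derive_comm Dop (@smooth_funP phi 2) Dx.
Qed.

(** The tensors are defined by functions on the whole space, with meaningless
    values outside [D]; only their values on [D] are recorded. *)
Definition represents f phi := forall x, D x -> f x = phi x.

Lemma represents_to_smooth f (Cf : smooth_on D f) : represents f (to_smooth Cf).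
Proof. by move=> x Dx; rewrite to_smoothE. Qed.

(** [D] is open, so the value of a derivative on [D] is determined by the
    values of the function on [D]. *)
Lemma represents_derive v f phi :
  represents f phi -> represents ('D_v f) (derivation v phi).
Proof.
move=> fphi x Dx; rewrite derivationE//; exact: near_derive_ext.
Qed.

Lemma representsD f g phi psi : represents f phi -> represents g psi ->
  represents (fun x => f x + g x) (phi + psi).
Proof. by move=> fp gp x Dx; rewrite smooth_funD fp// gp. Qed.

Lemma representsN f phi : represents f phi ->
  represents (fun x => - f x) (- phi).
Proof. by move=> fp x Dx; rewrite smooth_funN fp. Qed.

Lemma representsM f g phi psi : represents f phi -> represents g psi ->
  represents (fun x => f x * g x) (phi * psi).
Proof. by move=> fp gp x Dx; rewrite smooth_funM fp// gp. Qed.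

Lemma represents_cst c : represents (fun=> c) (smooth_cst c).
Proof. by move=> x Dx; rewrite to_smoothE. Qed.

Lemma represents_nat n : represents (fun=> n%:R) n%:R.
Proof. by move=> x Dx; rewrite -[RHS]/(smooth_eval Dx n%:R) rmorph_nat. Qed.

Lemma represents_sum (I : finType) (f : I -> V -> R) (phi : I -> S) :
  (forall i, represents (f i) (phi i)) ->
  represents (fun x => \sum_i f i x) (\sum_i phi i).
Proof.
move=> fp x Dx; rewrite -[RHS]/(smooth_eval Dx (\sum_i phi i)) rmorph_sum.
by apply: eq_bigr => i _; exact: fp.
Qed.

End SmoothRing.

(** * Derivations of a commutative ring *)

Section Calculus.
Variables (S : comPzRingType).
Implicit Types (a b : S) (d : S -> S).

Definition is_derivation d : Prop :=
  zmod_morphism d /\ (forall a b, d (a * b) = d a * b + a * d b).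

(** Proves an equation as a consequence of another one by a ring identity; linear
    combinations of equations are formed with [congr1] and [congr2]. *)
Lemma eq_of_diff (l r a b : S) : l = r -> a - b = l - r -> a = b.
Proof. by move=> -> H; apply: subr0_eq; rewrite H subrr. Qed.

Section Derivation.
Variable d : S -> S.
Hypothesis dP : is_derivation d.

Lemma derB a b : d (a - b) = d a - d b.
Proof. exact: dP.1. Qed.

Lemma derM a b : d (a * b) = d a * b + a * d b.
Proof. exact: dP.2. Qed.

Lemma der0 : d 0 = 0.
Proof. by have := derB 0 0; rewrite !subrr. Qed.

Lemma derN a : d (- a) = - d a.
Proof. by rewrite -sub0r derB der0 sub0r. Qed.

Lemma derD a b : d (a + b) = d a + d b.
Proof. by rewrite -{1}(opprK b) derB derN opprK. Qed.

Lemma der1 : d 1 = 0.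
Proof.
have := derM 1 1; rewrite !mulr1 mul1r => H.
by apply: (eq_of_diff (esym H)); ring.
Qed.

Lemma der_nat m : d m%:R = 0.
Proof. by elim: m => [|m IH]; rewrite ?der0// -natr1 derD IH der1 addr0. Qed.

Lemma der_natM m a : d (m%:R * a) = m%:R * d a.
Proof. by rewrite derM der_nat mul0r add0r. Qed.

Lemma der_sum (I : finType) (F : I -> S) : d (\sum_i F i) = \sum_i d (F i).
Proof. by apply: (big_morph d derD der0). Qed.

Lemma der_dot (I : finType) (A B : I -> S) :
  d (\sum_i A i * B i) = \sum_i d (A i) * B i + \sum_i A i * d (B i).
Proof. by rewrite der_sum -big_split; apply: eq_bigr => i _; exact: derM. Qed.

End Derivation.

End Calculus.

(** * The calculus of a spray *)

Lemma sum_deltal (S : comPzRingType) n (k : 'I_n) (F : 'I_n -> S) :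
  \sum_s (k == s)%:R * F s = F k.
Proof.
rewrite (bigD1 k)//= eqxx mul1r big1 ?addr0// => s sk.
by rewrite eq_sym (negbTE sk) mul0r.
Qed.

Lemma sum_deltar (S : comPzRingType) n (k : 'I_n) (F : 'I_n -> S) :
  \sum_s F s * (s == k)%:R = F k.
Proof.
by rewrite -[RHS](sum_deltal k); apply: eq_bigr => s _; rewrite mulrC eq_sym.
Qed.

(** The ring [S] stands for the smooth functions on a slit tangent bundle, [y] for
    the fibre coordinates, [G] for the spray coefficients, [E] for the square of
    the metric, and [a] for the inverse of the Hessian of [E] in the fibre. *)
Section SprayCalculus.
Variables (S : comPzRingType) (n : nat) (dx dy : 'I_n -> S -> S).
Variables (y G : 'I_n -> S) (E : S) (a : 'I_n -> 'I_n -> S).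
Implicit Types (f g : S) (i j k l m s t : 'I_n).

Hypothesis dxP : forall i, is_derivation (dx i).
Hypothesis dyP : forall i, is_derivation (dy i).
Hypothesis dxC : forall i j f, dx i (dx j f) = dx j (dx i f).
Hypothesis dyC : forall i j f, dy i (dy j f) = dy j (dy i f).
Hypothesis dyx : forall i j f, dy i (dx j f) = dx j (dy i f).
Hypothesis dx_y : forall i j, dx i (y j) = 0.
Hypothesis dy_y : forall i j, dy i (y j) = (i == j)%:R.
Hypothesis nat_cancel : forall (q : nat) f g, q.+1%:R * f = q.+1%:R * g -> f = g.

Local Notation e i := (dy i E).
Local Notation ee i j := (dy i (dy j E)).
Local Notation eee i j k := (dy i (dy j (dy k E))).

Hypothesis eeaV : forall i l, \sum_j ee i j * a j l = (i == l)%:R.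
Hypothesis aeeV : forall i l, \sum_j a i j * ee j l = (i == l)%:R.
Hypothesis euler : \sum_i y i * e i = 2 * E.
Hypothesis spray_eq : forall l,
  2 * \sum_i G i * ee i l = \sum_k y k * dx k (e l) - dx l E.

(** The spray [y^s d/dx^s - 2 G^s d/dy^s]. It is locked so that rewriting
    with the additivity of a derivation does not see the difference inside it. *)
Definition spray_der := locked (fun f =>
  \sum_s y s * dx s f - 2 * \sum_s G s * dy s f).

Lemma spray_der_def f :
  spray_der f = \sum_s y s * dx s f - 2 * \sum_s G s * dy s f.
Proof. by rewrite /spray_der -lock. Qed.

Local Notation X := spray_der.
Local Notation N i k := (dy k (G i)).
Local Notation H i k l := (dy k (dy l (G i))).
Local Notation B i j k l := (dy j (dy k (dy l (G i)))).

Lemma spray_derP : is_derivation X.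
Proof.
split=> [f g|f g]; rewrite !spray_der_def.
  rewrite (eq_bigr (fun s => y s * dx s f - y s * dx s g)); last first.
    by move=> s _; rewrite (derB (dxP s)) mulrBr.
  rewrite [in X in _ - _ * X](eq_bigr (fun s => G s * dy s f - G s * dy s g)).
    by rewrite !sumrB; ring.
  by move=> s _; rewrite (derB (dyP s)) mulrBr.
rewrite (eq_bigr (fun s => y s * dx s f * g + f * (y s * dx s g))); last first.
  by move=> s _; rewrite (derM (dxP s)); ring.
rewrite [in X in _ - _ * X](eq_bigr (fun s => G s * dy s f * g + f * (G s * dy s g))).
  by rewrite !big_split /= -!mulr_suml -!mulr_sumr; ring.
by move=> s _; rewrite (derM (dyP s)); ring.
Qed.

Lemma spray_der_y i : X (y i) = - 2 * G i.
Proof.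
rewrite !spray_der_def big1 => [|s _]; last by rewrite dx_y mulr0.
rewrite (eq_bigr (fun s => G s * (s == i)%:R)); last by move=> s _; rewrite dy_y.
by rewrite sum_deltar; ring.
Qed.

Lemma dy_spray_der k f :
  dy k (X f) = X (dy k f) + dx k f - 2 * \sum_s N s k * dy s f.
Proof.
rewrite !spray_der_def (derB (dyP k)) (der_natM (dyP k)) !(der_dot (dyP k)).
rewrite (eq_bigr (fun s => (k == s)%:R * dx s f)); last by move=> s _; rewrite dy_y.
rewrite sum_deltal (eq_bigr (fun s => y s * dx s (dy k f))); last first.
  by move=> s _; rewrite dyx.
rewrite [in X in 2 * (_ + X)](eq_bigr (fun s => G s * dy s (dy k f))); last first.
  by move=> s _; rewrite dyC.
by ring.
Qed.

Lemma dx_spray_der k f :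
  dx k (X f) = X (dx k f) - 2 * \sum_s dx k (G s) * dy s f.
Proof.
rewrite !spray_der_def (derB (dxP k)) (der_natM (dxP k)) !(der_dot (dxP k)).
rewrite big1 => [|s _]; last by rewrite dx_y mul0r.
rewrite (eq_bigr (fun s => y s * dx s (dx k f))); last first.
  by move=> s _; rewrite dxC.
rewrite [in X in 2 * (_ + X)](eq_bigr (fun s => G s * dy s (dx k f))); last first.
  by move=> s _; rewrite dyx.
by ring.
Qed.

Lemma eeC i j : ee i j = ee j i. Proof. exact: dyC. Qed.
Lemma eeeCl i j k : eee i j k = eee j i k. Proof. exact: dyC. Qed.
Lemma eeeCr i j k : eee i j k = eee i k j. Proof. by rewrite (dyC j). Qed.

Lemma hessian_y j : \sum_i y i * ee i j = e j.
Proof.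
have := congr1 (dy j) euler; rewrite (der_dot (dyP j)) (der_natM (dyP j)).
rewrite (eq_bigr (fun s => (j == s)%:R * e s)); last by move=> s _; rewrite dy_y.
rewrite sum_deltal => Ej.
rewrite (eq_bigr (fun i => y i * ee j i)); last by move=> i _; rewrite eeC.
by apply: (eq_of_diff Ej); ring.
Qed.

Lemma third_y j k : \sum_i y i * eee i j k = 0.
Proof.
have := congr1 (dy j) (hessian_y k); rewrite (der_dot (dyP j)).
rewrite (eq_bigr (fun s => (j == s)%:R * ee s k)); last by move=> s _; rewrite dy_y.
rewrite sum_deltal => Ej.
rewrite (eq_bigr (fun i => y i * eee j i k)); last by move=> i _; rewrite eeeCl.
by apply: (eq_of_diff Ej); ring.
Qed.

(** The Hessian of [E] is invertible, so lowering an index loses nothing. *)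
Lemma hessian_inj (A A' : 'I_n -> S) :
  (forall l, \sum_s A s * ee s l = \sum_s A' s * ee s l) -> A =1 A'.
Proof.
have K (B : 'I_n -> S) t : B t = \sum_l (\sum_s B s * ee s l) * a l t.
  rewrite (eq_bigr (fun l => \sum_s B s * ee s l * a l t)); last first.
    by move=> l _; rewrite mulr_suml.
  rewrite exchange_big /= -[LHS](sum_deltar t); apply: eq_bigr => s _.
  by rewrite -eeaV mulr_sumr; apply: eq_bigr => l _; ring.
by move=> AA t; rewrite (K A) (K A'); apply: eq_bigr => l _; rewrite AA.
Qed.

(** The Euler-Lagrange equations: this is how the spray is determined by [E]. *)
Lemma spray_der_e l : X (e l) = dx l E.
Proof.
rewrite !spray_der_def spray_eq; by ring.
Qed.

(** [X (y^s E_s)] is [X (2 E)] by homogeneity; it is also [X E], by the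
    Euler-Lagrange equations and the value of [X y]. Hence [2 X E = X E]. *)
Lemma spray_der_E : X E = 0.
Proof.
have := congr1 X euler; rewrite (der_natM spray_derP) (der_dot spray_derP).
rewrite (eq_bigr (fun s => - 2 * (G s * e s))); last first.
  by move=> s _; rewrite spray_der_y; ring.
rewrite -mulr_sumr [X in _ + X](eq_bigr (fun s => y s * dx s E)); last first.
  by move=> s _; rewrite spray_der_e.
move=> EX; apply: (eq_of_diff (esym EX)); rewrite !spray_der_def; by ring.
Qed.

(** The horizontal derivative of [E] vanishes: differentiate [X E = 0] in the
    fibre. *)
Lemma dx_E k : dx k E = \sum_s N s k * e s.
Proof.
have := dy_spray_der k E; rewrite spray_der_E (der0 (dyP k)) spray_der_e => E0.
by apply: (@nat_cancel 1); apply: (eq_of_diff (esym E0)); ring.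
Qed.

Definition lowered_N j l := \sum_s N s j * ee s l.
Local Notation P := lowered_N.

Let spray_der_ee0 j l : X (ee j l) + dx j (e l) - 2 * P j l = dx l (e j).
Proof. by rewrite /P -dy_spray_der spray_der_e dyx. Qed.

(** The fibre derivative of the Euler-Lagrange equations, antisymmetrized. The
    symmetric part is spray_der_ee, the metric compatibility along the spray. *)
Lemma curl_e j l : dx j (e l) - dx l (e j) = P j l - P l j.
Proof.
apply: (@nat_cancel 1).
have E1 := spray_der_ee0 j l; have := spray_der_ee0 l j; rewrite eeC => E2.
by apply: (eq_of_diff (congr2 (fun u v => u - v) E1 E2)); ring.
Qed.

Lemma spray_der_ee j l : X (ee j l) = P j l + P l j.
Proof.
have E1 := spray_der_ee0 j l; have E2 := curl_e j l.
by apply: (eq_of_diff (congr2 (fun u v => u - v) E1 E2)); ring.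
Qed.

Lemma lowered_N_y l : \sum_j y j * P l j = dx l E.
Proof.
rewrite dx_E (eq_bigr (fun j => \sum_s N s l * (y j * ee j s))); last first.
  move=> j _; rewrite /P mulr_sumr; apply: eq_bigr => s _; rewrite (eeC s); by ring.
rewrite exchange_big; apply: eq_bigr => s _ /=.
by rewrite -mulr_sumr hessian_y.
Qed.

(** Contracting curl_e with [y] gives this identity after lowering the index, so
    the homogeneity of [G] need not be derived from that of the inverse metric. *)
Lemma N_y i : \sum_j N i j * y j = 2 * G i.
Proof.
apply: (hessian_inj (A := fun i => \sum_j N i j * y j) (A' := fun i => 2 * G i)) => l.
have -> : \sum_s (\sum_j N s j * y j) * ee s l = \sum_j y j * P j l.
  rewrite (eq_bigr (fun s => \sum_j y j * (N s j * ee s l))); last first.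
    by move=> s _; rewrite mulr_suml; apply: eq_bigr => j _; ring.
  by rewrite exchange_big; apply: eq_bigr => j _; rewrite /P mulr_sumr.
have -> : \sum_s 2 * G s * ee s l = 2 * \sum_s G s * ee s l.
  by rewrite mulr_sumr; apply: eq_bigr => s _; ring.
rewrite spray_eq.
have yE : \sum_j y j * dx l (e j) = 2 * dx l E.
  rewrite -(der_natM (dxP l)) -euler (der_dot (dxP l)) [X in _ = X + _]big1 ?add0r//.
  by move=> s _; rewrite dx_y mul0r.
rewrite (eq_bigr (fun j => y j * dx j (e l) - y j * dx l (e j) + y j * P l j)).
  by rewrite big_split sumrB /= lowered_N_y yE; ring.
move=> j _; rewrite -mulrBr -mulrDr curl_e; by ring.
Qed.

Lemma spray_derE f : X f = \sum_s (dx s f - \sum_m N m s * dy m f) * y s.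
Proof.
rewrite (eq_bigr (fun s => y s * dx s f - \sum_m y s * (N m s * dy m f))); last first.
  by move=> s _; rewrite mulrBl mulr_suml mulrC; congr (_ - _); apply: eq_bigr => m _; ring.
rewrite sumrB exchange_big /= !spray_der_def mulr_sumr; congr (_ - _); apply: eq_bigr => m _.
rewrite mulrA -N_y mulr_suml; apply: eq_bigr => s _; by ring.
Qed.


Lemma HC i k l : H i k l = H i l k. Proof. exact: dyC. Qed.
Lemma BCl i j k l : B i j k l = B i k j l. Proof. exact: dyC. Qed.
Lemma BCr i j k l : B i j k l = B i j l k. Proof. by rewrite (dyC k). Qed.

(** The covariant derivative along the spray of the covariant 3-tensor [t]. *)
Definition spray_cov (t : 'I_n -> 'I_n -> 'I_n -> S) j k l :=
  X (t j k l) - \sum_s N s j * t s k l - \sum_s N s k * t j s l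
  - \sum_s N s l * t j k s.

(** Minus four times the Landsberg curvature, as [E_s = 2 y_s]. *)
Definition landsberg j k l := \sum_s e s * B s j k l.

(** Compare the second fibre derivative of dx_E with the fibre derivative of
    spray_der_ee: both contain [dE_jk/dx^l]. *)
Lemma spray_cov_third j k l :
  spray_cov (fun j k l => eee j k l) j k l = - landsberg j k l.
Proof.
have E1 := congr1 (dy j) (congr1 (dy k) (dx_E l)).
rewrite !dyx (der_dot (dyP k)) (derD (dyP j)) !(der_dot (dyP j)) in E1.
have E2 := congr1 (dy l) (spray_der_ee j k).
rewrite dy_spray_der (derD (dyP l)) /P !(der_dot (dyP l)) in E2.
have LE : landsberg j k l = \sum_s dy j (dy k (N s l)) * e s.
  by apply: eq_bigr => s _; rewrite mulrC.
have H1 : \sum_s H s l j * ee s k = \sum_s dy j (N s l) * dy k (e s).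
  by apply: eq_bigr => s _; rewrite HC eeC.
have H2 : \sum_s H s l k * ee s j = \sum_s dy k (N s l) * dy j (e s).
  by apply: eq_bigr => s _; rewrite HC eeC.
have C1 : \sum_s N s l * eee j k s = \sum_s N s l * eee s j k.
  by apply: eq_bigr => s _; rewrite eeeCr eeeCl.
have C2 : \sum_s N s j * dy l (ee s k) = \sum_s N s j * eee s k l.
  by apply: eq_bigr => s _; rewrite eeeCl eeeCr.
have C3 : \sum_s N s k * dy l (ee s j) = \sum_s N s k * eee j s l.
  by apply: eq_bigr => s _; rewrite eeeCl eeeCr eeeCl.
have C4 : eee l j k = eee j k l by rewrite eeeCl eeeCr.
rewrite /spray_cov LE C1; rewrite H1 H2 C2 C3 C4 in E2; rewrite C1 in E1.
by apply: (eq_of_diff (congr2 (fun u v => v - u) E1 E2)); ring.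
Qed.

Definition riem i k :=
  2 * dx k (G i) - X (N i k) - \sum_j N i j * N j k.

Lemma riemE i k : riem i k =
  2 * dx k (G i) - \sum_j y j * dx j (N i k) + 2 * \sum_j G j * dy j (N i k)
  - \sum_j N i j * N j k.
Proof. by rewrite /riem spray_der_def; ring. Qed.

(** The covariant derivative along the spray of the Berwald curvature. *)
Definition spray_cov_berwald i j k l :=
  X (B i j k l) + \sum_s N i s * B s j k l
  - \sum_s N s j * B i s k l - \sum_s N s k * B i j s l - \sum_s N s l * B i j k s.

(** The terms are arranged so that the cyclic sum in [k], [l], [m] can be read off:
    the derivatives of [H] in [x] and the products of two [H] have coefficients
    [2], [-1], [-1]. *)
Lemma dyy_riem i k l m : dy m (dy l (riem i k)) =
  2 * dx k (H i l m) - dx l (H i k m) - dx m (H i k l) - X (B i k l m)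
  + 2 * \sum_s N s m * B i k l s + 2 * \sum_s N s l * B i k s m
  - \sum_s N s k * B i s l m - \sum_s N i s * B s k l m
  + 2 * \sum_s H s l m * H i k s
  - \sum_s H s k m * H i l s - \sum_s H s k l * H i m s.
Proof.
rewrite /riem !(derB (dyP l)) (der_natM (dyP l)) dyx dy_spray_der (der_dot (dyP l)).
rewrite !(derB (dyP m)) !(derD (dyP m)) !(der_natM (dyP m)) !dyx dy_spray_der.
rewrite !(der_dot (dyP m)).
have S1 : B i k l m = dy m (dy l (N i k)).
  by rewrite BCl BCr BCl.
have S2 : \sum_s N s m * B i k l s = \sum_s N s m * dy s (dy l (N i k)).
  by apply: eq_bigr => s _; rewrite BCl BCr BCl.
have S3 : \sum_s N s l * B i k s m = \sum_s N s l * dy m (dy s (N i k)).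
  by apply: eq_bigr => s _; rewrite BCl BCr BCl.
have S4 : \sum_s N s k * B i s l m = \sum_s dy m (dy l (N i s)) * N s k.
  by apply: eq_bigr => s _; rewrite BCl BCr BCl mulrC.
have S5 : \sum_s N i s * B s k l m = \sum_s N i s * dy m (dy l (N s k)).
  by apply: eq_bigr => s _; rewrite BCl BCr BCl.
have S6 : \sum_s H s l m * H i k s = \sum_s dy m (N s l) * dy s (N i k).
  by apply: eq_bigr => s _; rewrite HC (HC i).
have S7 : \sum_s H s k m * H i l s = \sum_s dy l (N i s) * dy m (N s k).
  by apply: eq_bigr => s _; rewrite HC mulrC.
have S8 : \sum_s H s k l * H i m s = \sum_s dy m (N i s) * dy l (N s k).
  by apply: eq_bigr => s _; rewrite HC mulrC.
rewrite S1 S2 S3 S4 S5 S6 S7 S8.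
have -> : H i l m = dy m (N i l) by exact: dyC.
have -> : H i k m = dy m (N i k) by exact: dyC.
have -> : H i k l = dy l (N i k) by exact: dyC.
by ring.
Qed.

Lemma riem_cyclic i k l m :
  dy m (dy l (riem i k)) + dy k (dy m (riem i l)) + dy l (dy k (riem i m)) =
  - 3 * spray_cov_berwald i k l m.
Proof.
rewrite !dyy_riem /spray_cov_berwald.
have HHC (p q r : 'I_n) : \sum_s H s p q * H i r s = \sum_s H s q p * H i r s.
  by apply: eq_bigr => s _; rewrite HC.
rewrite (BCl _ m) (BCr _ k m) (BCr _ l m) (BCl _ l k) (HC i m k) (HC i m l) (HC i l k).
rewrite (HHC m k) (HHC m l) (HHC l k).
have BA p q (r : 'I_n) : \sum_s N s r * B i p s q = \sum_s N s r * B i p q s.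
  by apply: eq_bigr => s _; rewrite BCr.
have BB p q (r : 'I_n) : \sum_s N s r * B i s p q = \sum_s N s r * B i p q s.
  by apply: eq_bigr => s _; rewrite BCl BCr.
have BD p q (r : 'I_n) : \sum_s N s r * B i p q s = \sum_s N s r * B i q p s.
  by apply: eq_bigr => s _; rewrite BCl.
have BS p q (r : 'I_n) : \sum_s N i s * B s p q r = \sum_s N i s * B s q p r.
  by apply: eq_bigr => s _; rewrite BCl.
have BT p q (r : 'I_n) : \sum_s N i s * B s p q r = \sum_s N i s * B s p r q.
  by apply: eq_bigr => s _; rewrite BCr.
rewrite !BA !BB (BD m k) (BD m l) (BD l k) (BS m) (BT k m) (BT l m) (BS l k).
by ring.
Qed.

(** The covector [E_s] is parallel along the spray, by spray_der_e and dx_E. *)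
Lemma spray_cov_landsberg j k l :
  spray_cov landsberg j k l = \sum_i e i * spray_cov_berwald i j k l.
Proof.
have D (t : 'I_n -> 'I_n -> S) r : \sum_s N s r * (\sum_i e i * t s i) =
    \sum_i e i * \sum_s N s r * t s i.
  rewrite (eq_bigr (fun s => \sum_i N s r * (e i * t s i))); last first.
    by move=> s _; rewrite mulr_sumr.
  rewrite exchange_big; apply: eq_bigr => i _; rewrite mulr_sumr.
  by apply: eq_bigr => s _; ring.
have XE : \sum_s X (e s) * B s j k l = \sum_i e i * \sum_s N i s * B s j k l.
  rewrite (eq_bigr (fun s => \sum_i e i * (N i s * B s j k l))); last first.
    move=> s _; rewrite spray_der_e dx_E mulr_suml.
    by apply: eq_bigr => i _; ring.
  by rewrite exchange_big; apply: eq_bigr => i _; rewrite mulr_sumr.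
rewrite /spray_cov /landsberg (der_dot spray_derP) XE !D.
rewrite -big_split -!sumrB; apply: eq_bigr => i _ /=; rewrite /spray_cov_berwald; by ring.
Qed.

Definition riem_low k l := \sum_i riem i k * ee i l.

(** After lowering the index, [R] is [2 E_il dG^i/dx^k - X P_kl] plus a symmetric
    term. The antisymmetric part of [P] is the curl of [E_k], and the commutator
    of [X] with [d/dx^k] produces exactly the antisymmetric part of the first term. *)
Lemma riem_low_sym k l : riem_low k l = riem_low l k.
Proof.
have low p q : riem_low p q = 2 * \sum_i dx p (G i) * ee i q - X (P p q)
    + \sum_i N i p * P q i.
  rewrite /riem_low /P (der_dot spray_derP) mulr_sumr.
  have XE : \sum_i N i p * X (ee i q) =
    \sum_i \sum_s N s i * ee s q * N i p + \sum_i N i p * P q i.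
    rewrite -big_split; apply: eq_bigr => i _ /=.
    by rewrite spray_der_ee mulrDr -mulr_suml /P mulrC.
  rewrite XE exchange_big /=.
  rewrite (eq_bigr (fun i => 2 * (dx p (G i) * ee i q) - X (N i p) * ee i q
    - \sum_s N i s * ee i q * N s p)); last first.
    move=> i _; rewrite /riem !mulrBl mulr_suml mulrA; congr (_ - _).
    by apply: eq_bigr => s _; ring.
  by rewrite !sumrB; ring.
have NP : \sum_i N i k * P l i = \sum_i N i l * P k i.
  rewrite (eq_bigr (fun i => \sum_s N s l * (N i k * ee i s))); last first.
    by move=> i _; rewrite mulr_sumr; apply: eq_bigr => s _; rewrite (eeC s); ring.
  by rewrite exchange_big; apply: eq_bigr => s _; rewrite -mulr_sumr.
have := congr1 X (curl_e k l).
rewrite !(derB spray_derP).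
have X1 := dx_spray_der k (e l); have X2 := dx_spray_der l (e k).
rewrite spray_der_e in X1; rewrite spray_der_e dxC in X2.
move=> X3; rewrite !low NP.
by apply: (eq_of_diff (congr2 (fun u v => u - v) X3
  (congr2 (fun u v => v - u) X1 X2))); ring.
Qed.

Section ScalarCurvature.
Variables (K psi : S).
Hypothesis scalar : forall k l,
  2 * riem_low k l = K * (2 * E * ee k l - e k * e l).
Hypothesis isotropic : forall j k l, landsberg j k l = psi * eee j k l.

Lemma riem_scalar i k : 2 * riem i k = K * (2 * E * (k == i)%:R - y i * e k).
Proof.
apply: (hessian_inj (A := fun i => 2 * riem i k)
  (A' := fun i => K * (2 * E * (k == i)%:R - y i * e k))) => l.
rewrite (eq_bigr (fun i => 2 * (riem i k * ee i l))); last by move=> s _; ring.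
rewrite -mulr_sumr -[\sum_i _]/(riem_low k l) scalar.
rewrite [RHS](eq_bigr (fun s => 2 * K * E * ((k == s)%:R * ee s l)
  - K * e k * (y s * ee s l))); last by move=> s _; ring.
by rewrite sumrB -!mulr_sumr sum_deltal hessian_y; ring.
Qed.

Lemma riem_annihilates k : \sum_i e i * riem i k = 0.
Proof.
apply: (@nat_cancel 1); rewrite mulr_sumr mulr0.
rewrite (eq_bigr (fun i => 2 * K * E * ((k == i)%:R * e i) - K * e k * (y i * e i))).
  by rewrite sumrB -!mulr_sumr sum_deltal euler; ring.
by move=> i _; rewrite mulrCA riem_scalar; ring.
Qed.

(** Four times [F^2 h_kl], where [h] is the angular metric. *)
Definition quad k l := 2 * E * ee k l - e k * e l.

(** Differentiate [E_i R^i_k = 0] twice in the fibre: this moves both derivatives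
    onto the lowered tensor, whose form is known. *)
Lemma e_dyy_riem k l m : 2 * \sum_i e i * dy m (dy l (riem i k)) =
  2 * K * E * eee k l m - dy m (K * quad k l) - dy l (K * quad k m).
Proof.
have first_der p q : \sum_i e i * dy p (riem i q) = - riem_low q p.
  have := congr1 (dy p) (riem_annihilates q).
  rewrite (der_dot (dyP p)) (der0 (dyP p)) => H0.
  have low : riem_low q p = \sum_i dy p (e i) * riem i q.
    by apply: eq_bigr => i _; rewrite eeC mulrC.
  by apply: (eq_of_diff H0); rewrite low; ring.
have H1 := congr1 (dy m) (first_der l k).
rewrite (der_dot (dyP m)) (derN (dyP m)) in H1.
have H2 : dy l (riem_low k m) = \sum_i dy l (riem i k) * ee i m
    + \sum_i riem i k * eee l i m by rewrite /riem_low (der_dot (dyP l)).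
have H3 : \sum_i dy m (e i) * dy l (riem i k) = \sum_i dy l (riem i k) * ee i m.
  by apply: eq_bigr => i _; rewrite eeC mulrC.
have H4 : 2 * \sum_i riem i k * eee l i m = 2 * (K * E * eee k l m).
  rewrite mulr_sumr (eq_bigr (fun i => 2 * (K * E) * ((k == i)%:R * eee i l m) -
    K * e k * (y i * eee i l m))); last first.
    by move=> i _; rewrite mulrA riem_scalar (eeeCl l); ring.
  by rewrite sumrB -!mulr_sumr sum_deltal third_y; ring.
have {}H4 := @nat_cancel 1 _ _ H4.
rewrite -!scalar !(der_natM (dyP _)) H2 H4 -H3.
rewrite H3 in H1; rewrite H3.
by have := congr1 (fun u => 2 * u) H1 => H5; apply: (eq_of_diff H5); ring.
Qed.

(** Equates two expressions for the covariant derivative of [landsberg] along the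
    spray, one from isotropy, the other from riem_cyclic and scalar curvature. *)
Lemma third_derivative_scalar k l m :
  3 * (X psi - psi ^+ 2 - K * E) * eee k l m =
  dy k K * quad l m + dy l K * quad m k + dy m K * quad k l.
Proof.
have covc p q r : spray_cov (fun j k l => psi * eee j k l) p q r =
    X psi * eee p q r + psi * spray_cov (fun j k l => eee j k l) p q r.
  have D (t : 'I_n -> S) u : \sum_s N s u * (psi * t s) = psi * \sum_s N s u * t s.
    by rewrite mulr_sumr; apply: eq_bigr => s _; ring.
  by rewrite /spray_cov (derM spray_derP) !D; ring.
(* By isotropy and the Leibniz rule: the derivative of [E_jkl] is [- psi E_jkl]. *)
have H1 : spray_cov landsberg k l m = (X psi - psi ^+ 2) * eee k l m.
  rewrite (_ : spray_cov landsberg k l m = spray_cov (fun j k l => psi * eee j k l) k l m).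
    by rewrite covc spray_cov_third isotropic; ring.
  rewrite /spray_cov isotropic; congr (_ - _ - _ - _); by apply: eq_bigr => s _; rewrite isotropic.
have H2 : \sum_i e i * dy m (dy l (riem i k)) + \sum_i e i * dy k (dy m (riem i l))
    + \sum_i e i * dy l (dy k (riem i m)) = - 3 * ((X psi - psi ^+ 2) * eee k l m).
  rewrite -H1 spray_cov_landsberg -!big_split mulr_sumr; apply: eq_bigr => i _ /=.
 
  by rewrite mulrCA -riem_cyclic; ring.
have dy_quad p q r : dy r (K * quad p q) = dy r K * quad p q + K *
    (2 * e r * ee p q + 2 * E * eee r p q - ee r p * e q - e p * ee r q).
  by rewrite (derM (dyP r)) (derB (dyP r)) !(derM (dyP r)) (der_nat (dyP r)); ring.
have qC p q : quad p q = quad q p by rewrite /quad eeC; ring.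
have H3 := congr1 (fun u => 2 * u) H2; rewrite /= !mulrDr !e_dyy_riem !dy_quad in H3.
rewrite (eeeCl m k l) (eeeCr k m l) (eeeCl l k m) (eeeCl m l k) (eeeCr l m k) in H3.
rewrite (eeeCl l k m) (qC l k) (qC m l) (qC k m) (eeC m k) (eeC m l) (eeC l k) in H3.
apply: (@nat_cancel 1).
by apply: (eq_of_diff H3); ring.
Qed.

Hypothesis E_cancel : forall f g, E * f = E * g -> f = g.
Hypothesis n_gt1 : (1 < n)%N.

Lemma trace_hessian : \sum_k \sum_l a k l * ee k l = n%:R.
Proof.
rewrite (eq_bigr (fun=> 1)); first by rewrite sumr_const card_ord.
move=> k _; transitivity (\sum_j a k j * ee j k); last by rewrite aeeV eqxx.
by apply: eq_bigr => l _; rewrite eeC.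
Qed.

Lemma inverse_hessian_e k : \sum_l a k l * e l = y k.
Proof.
rewrite (eq_bigr (fun l => \sum_i a k l * (ee l i * y i))); last first.
  move=> l _; rewrite -mulr_sumr -hessian_y; congr (_ * _).
  by apply: eq_bigr => i _; rewrite eeC mulrC.
rewrite exchange_big /= -[RHS](sum_deltal k); apply: eq_bigr => i _.
by rewrite -aeeV mulr_suml; apply: eq_bigr => l _; ring.
Qed.

Lemma trace_quad : \sum_k \sum_l a k l * quad k l = 2 * E * (n%:R - 1).
Proof.
rewrite (eq_bigr (fun k => 2 * E * (\sum_l a k l * ee k l) - e k * y k)).
  rewrite sumrB -mulr_sumr trace_hessian.
  rewrite [X in _ - X](eq_bigr (fun k => y k * e k)) ?euler; last by move=> k _; ring.
  by ring.
move=> k _; rewrite -inverse_hessian_e !mulr_sumr -sumrB; apply: eq_bigr => l _.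
by rewrite /quad; ring.
Qed.

(** Contracting third_derivative_scalar with [y] kills everything except the term
    in [y^k dK/dy^k], whose coefficient has nonzero trace because [1 < n]. *)
Lemma K_homogeneous : \sum_k y k * dy k K = 0.
Proof.
set kap := \sum_k _.
have H0 l m : kap * quad l m = 0.
  have : \sum_k y k * (3 * (X psi - psi ^+ 2 - K * E) * eee k l m) = 0.
    rewrite (eq_bigr (fun k => 3 * (X psi - psi ^+ 2 - K * E) * (y k * eee k l m))).
      by rewrite -mulr_sumr third_y mulr0.
    by move=> k _; ring.
  have yq p : \sum_k y k * quad k p = 0.
    rewrite (eq_bigr (fun k => 2 * E * (y k * ee k p) - e p * (y k * e k))).
      by rewrite sumrB -!mulr_sumr hessian_y euler; ring.
    by move=> k _; rewrite /quad; ring.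
  have yq' p : \sum_k y k * quad p k = 0.
    by rewrite -[RHS](yq p); apply: eq_bigr => k _; rewrite /quad eeC; ring.
  rewrite (eq_bigr (fun k => y k * dy k K * quad l m + dy l K * (y k * quad m k)
    + dy m K * (y k * quad k l))); last first.
    by move=> k _; rewrite third_derivative_scalar; ring.
  rewrite !big_split /= -!mulr_sumr yq yq' -mulr_suml !mulr0 !addr0.
  exact.
have : kap * (\sum_k \sum_l a k l * quad k l) = 0.
  rewrite mulr_sumr big1// => k _; rewrite mulr_sumr big1// => l _.
  by rewrite mulrCA H0 mulr0.
rewrite trace_quad.
have [q nE] : exists q, n = q.+2 by case: n n_gt1 => [|[|q]]// _; exists q.
rewrite nE => H1; apply: (@nat_cancel 1); apply: (@nat_cancel q); apply: E_cancel.
by apply: (eq_of_diff H1); rewrite -!natr1; ring.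
Qed.

Lemma contracted_identity m :
  3 * (psi ^+ 2 + K * E - X psi) * (\sum_k \sum_l a k l * eee k l m)
  + 2 * E * (n%:R + 1) * dy m K = 0.
Proof.
have qC p q : quad p q = quad q p by rewrite /quad eeC; ring.
have aq p r : \sum_l a p l * quad r l = 2 * E * (p == r)%:R - e r * y p.
  rewrite -inverse_hessian_e -aeeV !mulr_sumr -sumrB.
  by apply: eq_bigr => l _; rewrite /quad (eeC r); ring.
have qa p r : \sum_k a k p * quad k r = 2 * E * (r == p)%:R - e r * y p.
  have ya : \sum_k e k * a k p = y p.
    rewrite (eq_bigr (fun k => \sum_i y i * (ee i k * a k p))); last first.
      move=> k _; transitivity ((\sum_i y i * ee i k) * a k p).
        by rewrite hessian_y.
      by rewrite mulr_suml; apply: eq_bigr => i _; ring.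
    rewrite exchange_big /= -[RHS](sum_deltar p); apply: eq_bigr => i _.
    by rewrite -mulr_sumr eeaV.
  rewrite -ya -eeaV !mulr_sumr -sumrB.
  by apply: eq_bigr => k _; rewrite /quad (eeC k); ring.
have S1 : \sum_k \sum_l a k l * (dy k K * quad l m) = 2 * E * dy m K.
  rewrite (eq_bigr (fun k => 2 * E * (dy k K * (k == m)%:R) - e m * (y k * dy k K))).
    by rewrite sumrB -!mulr_sumr sum_deltar K_homogeneous; ring.
  move=> k _; transitivity (dy k K * \sum_l a k l * quad m l); last by rewrite aq; ring.
  by rewrite mulr_sumr; apply: eq_bigr => l _; rewrite (qC l); ring.
have S2 : \sum_k \sum_l a k l * (dy l K * quad m k) = 2 * E * dy m K.
  rewrite exchange_big /=.
  rewrite (eq_bigr (fun l => 2 * E * ((m == l)%:R * dy l K) - e m * (y l * dy l K))).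
    by rewrite sumrB -!mulr_sumr sum_deltal K_homogeneous; ring.
  move=> l _; transitivity (dy l K * \sum_k a k l * quad k m); last by rewrite qa; ring.
  by rewrite mulr_sumr; apply: eq_bigr => k _; rewrite (qC m); ring.
have S3 : \sum_k \sum_l a k l * (dy m K * quad k l) =
    2 * E * (n%:R - 1) * dy m K.
  rewrite -trace_quad mulr_suml; apply: eq_bigr => k _.
  by rewrite mulr_suml; apply: eq_bigr => l _; ring.
have S0 : \sum_k \sum_l a k l * (3 * (X psi - psi ^+ 2 - K * E) * eee k l m) =
    3 * (X psi - psi ^+ 2 - K * E) * \sum_k \sum_l a k l * eee k l m.
  rewrite mulr_sumr; apply: eq_bigr => k _; rewrite mulr_sumr.
  by apply: eq_bigr => l _; ring.
have := S0; rewrite (eq_bigr (fun k => \sum_l a k l * (dy k K * quad l m)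
  + \sum_l a k l * (dy l K * quad m k) + \sum_l a k l * (dy m K * quad k l))).
  rewrite !big_split /= S1 S2 S3 => H.
  by apply: (eq_of_diff H); ring.
move=> k _; rewrite -!big_split; apply: eq_bigr => l _ /=.
by rewrite third_derivative_scalar; ring.
Qed.

End ScalarCurvature.
End SprayCalculus.

(** * Quadratic forms on row vectors *)

Section Forms.
Variables (R : realType) (n : nat).
Implicit Types (g s t : 'M[R]_n) (u v w y : 'rV[R]_n).

Definition form s u v : R := (u *m s *m v^T) 0 0.

Lemma formE s u v : form s u v = \sum_i \sum_j s i j * u 0 i * v 0 j.
Proof.
rewrite /form mxE exchange_big; apply: eq_bigr => j _ /=.
by rewrite !mxE mulr_suml; apply: eq_bigr => i _; rewrite [u 0 i * _]mulrC.
Qed.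

Lemma formC s u v : s^T = s -> form s u v = form s v u.
Proof.
move=> sT; rewrite /form -[in RHS]sT.
rewrite (_ : (v *m s^T *m u^T) = (u *m s *m v^T)^T) ?mxE//.
by rewrite !trmx_mul trmxK mulmxA.
Qed.

Lemma formDl s u v w : form s (u + v) w = form s u w + form s v w.
Proof. by rewrite /form !mulmxDl mxE. Qed.

Lemma formZl s (c : R) u w : form s (c *: u) w = c * form s u w.
Proof. by rewrite /form -!scalemxAl mxE. Qed.

Lemma formDr s u v w : form s w (u + v) = form s w u + form s w v.
Proof. by rewrite /form linearD mulmxDr mxE. Qed.

Lemma formZr s (c : R) u w : form s w (c *: u) = c * form s w u.
Proof. by rewrite /form linearZ -scalemxAr mxE. Qed.

Lemma formBm s t u v : form (s - t) u v = form s u v - form t u v.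
Proof. by rewrite /form mulmxBr mulmxBl !mxE. Qed.

Lemma formZm (c : R) s u v : form (c *: s) u v = c * form s u v.
Proof. by rewrite /form -scalemxAr -scalemxAl mxE. Qed.

Lemma form_delta s i j : form s (delta_mx 0 i) (delta_mx 0 j) = s i j.
Proof. by rewrite /form -rowE trmx_delta -colE !mxE. Qed.

Lemma free_pairP y u :
  reflect (y != 0 /\ forall c, u != c *: y) (free [:: y; u]).
Proof.
have -> : free [:: y; u] = free [:: u; y].
  by apply: perm_free; exact: (permEl (perm_catC [:: y] [:: u])).
rewrite free_cons span_seq1 seq1_free; apply: (iffP andP).
  move=> [uy y0]; split=> // c; apply: contraNneq uy => ->.
  by apply/vlineP; exists c.
move=> [y0 uy]; split=> //; apply/negP => /vlineP[c uE].
by move: (uy c); rewrite uE eqxx.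
Qed.

(** Evaluate the form at the component of [u] orthogonal to [y], scaled by
    [g(y, y)]. *)
Lemma cauchy_schwarz_strict g y u : g^T = g ->
  (forall v, v != 0 -> 0 < form g v v) -> free [:: y; u] ->
  0 < form g y y * form g u u - form g y u ^+ 2.
Proof.
move=> gT gpos /free_pairP [y0 uy].
have yy := gpos _ y0.
pose w := form g y y *: u + (- form g y u) *: y.
have w0 : w != 0.
  apply/eqP => wE; move/eqP: (uy ((form g y y)^-1 * form g y u)); apply.
  rewrite -scalerA; have -> : form g y u *: y = form g y y *: u.
    by apply/esym/subr0_eq; rewrite -scaleNr.
  by rewrite scalerA mulVf ?scale1r// gt_eqF.
have := gpos _ w0.
have -> : form g w w = form g y y * (form g y y * form g u u - form g y u ^+ 2).
  rewrite /w !(formDl, formDr, formZl, formZr) (formC u y gT); ring.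
by rewrite pmulr_rgt0.
Qed.

(** A vector [u] proportional to [y] lies on a line [u + t w] of which all other
    points are independent of [y]; a polynomial of degree two in [t] that
    vanishes for all nonzero [t] vanishes at [0]. *)
Lemma form_eq0_of_free s y : (1 < n)%N -> y != 0 -> s^T = s ->
  (forall u, free [:: y; u] -> form s u u = 0) -> s = 0.
Proof.
move=> n1 y0 sT s0.
have [w yw] : exists w, free [:: y; w].
  apply: contrapT => nw.
  have yw w : exists c, w = c *: y.
    apply: contrapT => nc; apply: nw; exists w; apply/free_pairP; split=> // c.
    by apply/eqP => wE; apply: nc; exists c.
  have ful : (fullv <= <[y]>)%VS.
    by apply/subvP => w _; have [c ->] := yw w; rewrite memvZ// memv_line.
  have := dimvS ful; rewrite dimvf dim_vline y0 /dim /= mul1n.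
  by case: n n1 => [|[|]].
have /free_pairP [_ yw'] := yw.
(* It remains to treat the multiples of [y]. *)
have Q0 u : form s u u = 0.
  have [/s0 //|/free_pairP nf] := boolP (free [:: y; u]).
  have [c uE] : exists c, u = c *: y.
    apply: contrapT => nc; apply: nf; split=> // c.
    by apply/eqP => uE; apply: nc; exists c.
  have fr (t : R) : t != 0 -> free [:: y; u + t *: w].
    move=> t0; apply/free_pairP; split=> // d; apply/eqP => E.
    move/eqP: (yw' (t^-1 * (d - c))); apply.
    rewrite -scalerA scalerBl -E uE addrC addKr scalerA mulVf ?scale1r//.
  have := s0 _ (fr 1 (oner_neq0 _)); have := s0 _ (fr (-1) _).
  rewrite oppr_eq0 oner_neq0 => /(_ isT).
  rewrite !(formDl, formDr, formZl, formZr) (formC w u sT) (s0 w yw) => E1 E2.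
  by lra.
apply/matrixP => i j; rewrite mxE.
have := Q0 (delta_mx 0 i + delta_mx 0 j).
rewrite !(formDl, formDr) !Q0 (formC _ (delta_mx 0 i) sT) form_delta.
by lra.
Qed.

End Forms.

(** * Finsler tensors in local coordinates *)

Section Bridge.
Variables (R : realType) (n : nat).
Local Notation V := ('rV[R]_n * 'rV[R]_n)%type.
Variables (D : set V) (Dop : open D).
Implicit Types (i j k l s : 'I_n) (p q : V) (f : V -> R).

Local Notation S := (smooth_fun Dop).

(** Names ending in [S] denote the elements and the operations of the ring of
    smooth functions that correspond to the coordinate objects. *)
Definition dxS i : S -> S := @derivation R V D Dop (delta_mx 0 i, 0).
Definition dyS i : S -> S := @derivation R V D Dop (0, delta_mx 0 i).

Lemma dxS_der i : is_derivation (dxS i).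
Proof. by split; [exact: derivationB | exact: derivationM]. Qed.
Lemma dyS_der i : is_derivation (dyS i).
Proof. by split; [exact: derivationB | exact: derivationM]. Qed.

Lemma dxS_comm i j (f : S) : dxS i (dxS j f) = dxS j (dxS i f).
Proof. exact: derivationC. Qed.
Lemma dyS_comm i j (f : S) : dyS i (dyS j f) = dyS j (dyS i f).
Proof. exact: derivationC. Qed.
Lemma dyxS_comm i j (f : S) : dyS i (dxS j f) = dxS j (dyS i f).
Proof. exact: derivationC. Qed.

Definition fibre_coord i : V -> R := fun p => p.2 0 i.

Fact fibre_coord_linear i : linear (fibre_coord i).
Proof. by move=> c u v; rewrite /fibre_coord /= !mxE. Qed.

HB.instance Definition _ i :=
  GRing.isLinear.Build R V R *%R (fibre_coord i) (fibre_coord_linear i).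

Lemma fibre_coord_continuous i : continuous (fibre_coord i).
Proof.
move=> p; apply: (@continuous_comp _ _ _ snd (fun y : 'rV[R]_n => y 0 i)).
  exact: cvg_snd.
exact: coord_continuous.
Qed.

Fact fibre_coord_smooth i : smooth_on D (fibre_coord i).
Proof. by move=> k; apply: Ck_linear; exact: fibre_coord_continuous. Qed.

Definition yS i : S := to_smooth Dop (fibre_coord_smooth i).

Lemma yS_val i p : D p -> yS i p = p.2 0 i.
Proof. exact: to_smoothE. Qed.

Lemma derivation_yS v i p : D p -> @derivation R V D Dop v (yS i) p = v.2 0 i.
Proof.
move=> Dp; apply: etrans (derivationE _ _ Dp) _.
have -> : 'D_v (yS i) p = 'D_v (fibre_coord i) p.
  by apply: near_derive_ext Dop _ _ _ _ Dp _ => q; exact: to_smoothE.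
have fc := @fibre_coord_continuous i.
by rewrite deriveE ?diff_lin//; exact: linear_differentiable.
Qed.

Lemma dxS_y i j : dxS i (yS j) = 0.
Proof.
apply: smooth_fun_ext => p Dp.
by apply: etrans (derivation_yS _ _ Dp) _; rewrite mxE.
Qed.

Lemma smooth_nat m p : D p -> (m%:R : S) p = m%:R.
Proof. by move=> Dp; exact: esym (@represents_nat R V D Dop m p Dp). Qed.

Lemma dyS_y i j : dyS i (yS j) = (i == j)%:R.
Proof.
apply: smooth_fun_ext => p Dp.
apply: etrans (derivation_yS _ _ Dp) _.
by rewrite smooth_nat// mxE eqxx /= eq_sym.
Qed.

Lemma S_nat_cancel (m : nat) (f g : S) : m.+1%:R * f = m.+1%:R * g -> f = g.
Proof.
move=> fg; apply: smooth_fun_ext => p Dp.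
have fgp : (m.+1%:R * f : S) p = (m.+1%:R * g : S) p by rewrite fg.
rewrite !smooth_funM smooth_nat// in fgp.
by apply: mulfI fgp; rewrite pnatr_eq0.
Qed.

Lemma represents_partial_y i f (phi : S) :
  represents f phi -> represents (partial_y i f) (dyS i phi).
Proof. exact: represents_derive. Qed.

Lemma represents_partial_x i f (phi : S) :
  represents f phi -> represents (partial_x i f) (dxS i phi).
Proof. exact: represents_derive. Qed.


Variable F : V -> R.
Hypothesis D_slit : forall p, D p -> p.2 != 0.
Hypothesis F_ge0 : forall p, D p -> 0 <= F p.
Hypothesis F_smooth : smooth_on D F.
Hypothesis F_homogeneous : forall p (t : R), D p -> 0 < t ->
  F (p.1, t *: p.2) = t * F p.
Hypothesis F_posdef : forall p (u : 'rV[R]_n), D p -> u != 0 ->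
  0 < fund_product F p u u.

Definition FS : S := to_smooth Dop F_smooth.
Definition ES : S := FS * FS.

Local Notation e i := (dyS i ES).
Local Notation ee i j := (dyS i (dyS j ES)).
Local Notation eee i j k := (dyS i (dyS j (dyS k ES))).

Lemma FS_represents : represents F FS.
Proof. exact: represents_to_smooth. Qed.

Lemma ES_represents : represents (square F) ES.
Proof.
move=> p Dp; apply: etrans _ (esym (smooth_funM _ _ _)).
by rewrite /square -FS_represents.
Qed.

(** Differentiate the homogeneity relation in the scaling factor at [1]. *)
Lemma euler_F p : D p -> 'D_(0, p.2) F p = F p.
Proof.
move=> Dp.
have pE : p = (1 : R) *: (0, p.2) + (p.1, 0) :> V.
  by rewrite scale1r; case: p {Dp} => x y /=; congr pair; rewrite /= ?add0r ?addr0.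
have dF : derivable F p (0, p.2).
  by apply: diff_derivable; have [+ _] := F_smooth 1; exact.
have L : is_derive (1 : R) 1 (fun t : R => F (t *: (0, p.2) + (p.1, 0)))
    ('D_(0, p.2) F p).
  have := @is_derive_line R V F (0, p.2) (p.1, 0) 1.
  by rewrite -pE => /(_ dF).
have [_ <-] := L.
transitivity ('D_1 (F p \o* (@id R)) (1 : R)); last first.
  have did : derivable (@id R) (1 : R) (1 : R) by exact: derivable_id.
  by have := deriveMr (F p) did; rewrite derive_id mulr1.
apply: near_eq_derive.
have : \forall t \near (1 : R), 0 < t by exact: lt_nbhsr.
apply: filterS => t t0 /=.
apply: etrans _ (F_homogeneous Dp t0).
by congr F; congr pair; rewrite /= ?scaler0 ?add0r ?addr0.
Qed.


Lemma euler_FS : \sum_i yS i * dyS i FS = FS.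
Proof.
apply: smooth_fun_ext => p Dp.
have yF : represents (fun q => \sum_i q.2 0 i * partial_y i F q)
    (\sum_i yS i * dyS i FS).
  apply: represents_sum => i; apply: representsM; first by move=> q Dq; rewrite yS_val.
  exact: represents_partial_y FS_represents.
apply: etrans (esym (yF p Dp)) _.
apply: etrans _ (FS_represents Dp); apply: etrans _ (euler_F Dp).
have dF : differentiable F p by have [+ _] := F_smooth 1; exact.
have pE : (0, p.2) = \sum_i p.2 0 i *: (0, delta_mx 0 i) :> V.
  have fsts : (\sum_i p.2 0 i *: (0, delta_mx 0 i) : V).1 = 0.
    rewrite (big_morph (fun v : V => v.1) (id1 := 0) (op1 := +%R))//.
    by apply: big1 => i _; rewrite /= scaler0.
  have snds : (\sum_i p.2 0 i *: (0, delta_mx 0 i) : V).2 = p.2.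
    rewrite (big_morph (fun v : V => v.2) (id1 := 0) (op1 := +%R))//.
    by rewrite [RHS]row_sum_delta.
  by rewrite [RHS]surjective_pairing fsts snds.
apply: esym; apply: etrans (deriveE _ dF) _.
rewrite pE linear_sum; apply: eq_bigr => i _.
by rewrite linearZ /=; congr (_ * _); exact: esym (deriveE _ dF).
Qed.

Lemma euler_ES : \sum_i yS i * e i = 2 * ES.
Proof.
rewrite (eq_bigr (fun i => 2 * FS * (yS i * dyS i FS))); last first.
  by move=> i _; rewrite (derM (dyS_der i)); ring.
by rewrite -mulr_sumr euler_FS /ES; ring.
Qed.

Definition half : S := smooth_cst Dop 2^-1.

Lemma half2 : 2 * half = 1.
Proof.
apply: smooth_fun_ext => p Dp.
have -> : (1 : S) p = 1 by exact: (smooth_nat 1 Dp).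
rewrite smooth_funM smooth_nat// -(represents_cst _ _ Dp).
by rewrite mulfV// pnatr_eq0.
Qed.

Lemma represents_half : represents (fun=> 2^-1) half.
Proof. exact: represents_cst. Qed.

Lemma represents_fund i j : represents (fun p => fund_tensor F p i j) (half * ee i j).
Proof.
move=> p Dp; rewrite mxE.
apply: (@representsM _ _ _ _ (fun=> 2^-1) _ half (ee i j) represents_half _ p Dp).
exact/represents_partial_y/represents_partial_y/ES_represents.
Qed.

Lemma fund_unit p : D p -> fund_tensor F p \in unitmx.
Proof.
move=> Dp; rewrite -row_free_unit -kermx_eq0; apply/rowV0P => v /sub_kermxP vg.
apply/eqP; apply: contraT => v0; have := F_posdef Dp v0.
suff -> : fund_product F p v v = (v *m fund_tensor F p *m v^T) 0 0.
  by rewrite vg mul0mx mxE ltxx.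
rewrite mxE /fund_product exchange_big; apply: eq_bigr => j _ /=.
rewrite !mxE mulr_suml; apply: eq_bigr => i _.
by rewrite [v 0 i * _]mulrC.
Qed.

Definition hessian : 'M[S]_n := \matrix_(i, j) ee i j.

Lemma hessian_fund p (Dp : D p) :
  map_mx (@smooth_eval R V D Dop p Dp) hessian = 2 *: fund_tensor F p.
Proof.
apply/matrixP => i j; rewrite [RHS]mxE (represents_fund i j Dp) !mxE smooth_funM.
rewrite -(represents_half Dp) mulrA mulfV ?pnatr_eq0// mul1r; reflexivity.
Qed.

Lemma det_hessian_inverse : exists d : S, \det hessian * d = 1.
Proof.
apply: smooth_inverse => p Dp.
have -> : (\det hessian : S) p = \det (2 *: fund_tensor F p).
  by rewrite -(hessian_fund Dp) det_map_mx.
by rewrite detZ mulf_neq0 ?expf_neq0 ?pnatr_eq0// -unitfE -unitmxE fund_unit.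
Qed.

(** The adjugate of the Hessian over the ring, divided by its determinant, which
    vanishes nowhere by positive definiteness. *)
Lemma hessian_inverse : exists a : 'I_n -> 'I_n -> S,
  (forall i l, \sum_j ee i j * a j l = (i == l)%:R) /\
  (forall i l, \sum_j a i j * ee j l = (i == l)%:R).
Proof.
have [d dK] := det_hessian_inverse.
exists (fun i j => d * \adj hessian i j); split => i l.
  have := congr1 (fun M : 'M[S]_n => M i l) (mul_mx_adj hessian); rewrite /= !mxE => H.
  transitivity (d * \sum_j hessian i j * (\adj hessian) j l).
    by rewrite mulr_sumr; apply: eq_bigr => j _; rewrite !mxE; ring.
  by rewrite H mulrnAr mulrC dK.
have := congr1 (fun M : 'M[S]_n => M i l) (mul_adj_mx hessian); rewrite /= !mxE => H.
transitivity (d * \sum_j (\adj hessian) i j * hessian j l).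
  by rewrite mulr_sumr; apply: eq_bigr => j _; rewrite !mxE; ring.
by rewrite H mulrnAr mulrC dK.
Qed.


Section Inverse.
Variable a : 'I_n -> 'I_n -> S.
Hypothesis eeaV : forall i l, \sum_j ee i j * a j l = (i == l)%:R.
Hypothesis aeeV : forall i l, \sum_j a i j * ee j l = (i == l)%:R.

Lemma represents_inv_fund i j :
  represents (fun p => inv_fund_tensor F p i j) (2 * a i j).
Proof.
move=> p Dp.
pose B : 'M[R]_n := \matrix_(i, j) (2 * a i j : S) p.
have gB : fund_tensor F p *m B = 1%:M.
  apply/matrixP => r s; rewrite !mxE.
  have H : represents (fun p => \sum_t fund_tensor F p r t * (2 * a t s : S) p)
      ((r == s)%:R : S).
    have <- : \sum_t half * ee r t * (2 * a t s) = (r == s)%:R.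
      rewrite -eeaV; apply: eq_bigr => t _.
      transitivity ((2 * half) * (ee r t * a t s)); first by ring.
      by rewrite half2 mul1r.
    apply: represents_sum => t; apply: representsM => //; exact: represents_fund.
  rewrite -(smooth_nat (r == s) Dp) -H//.
  by apply: eq_bigr => t _; rewrite [X in _ * X]mxE.
have -> : inv_fund_tensor F p = B.
  by rewrite -[RHS](mulKmx (fund_unit Dp)) gB mulmx1.
by rewrite mxE.
Qed.

(** The fundamental tensor is half of the Hessian of [E], so its inverse is
    [2 a]. *)
Definition GS i : S := half * half * \sum_l 2 * a i l *
  ((\sum_k dxS k (e l) * yS k) - dxS l ES).

Lemma represents_4V : represents (fun=> 4^-1) (half * half).
Proof.
move=> p Dp; apply: etrans _ (esym (smooth_funM _ _ _)).
by rewrite -(represents_half Dp) -invfM -natrM.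
Qed.

Lemma represents_spray i : represents (spray F i) (GS i).
Proof.
apply: (representsM represents_4V).
apply: represents_sum => l; apply: (representsM (represents_inv_fund i l)).
apply: (@representsD _ _ _ _ _ (fun p => - partial_x l (square F) p)); last first.
  apply: representsN; exact: represents_partial_x ES_represents.
apply: represents_sum => k; apply: representsM; last by move=> q Dq; rewrite yS_val.
exact/represents_partial_x/represents_partial_y/ES_represents.
Qed.

Lemma spray_eq_GS l :
  2 * \sum_i GS i * ee i l = \sum_k yS k * dxS k (e l) - dxS l ES.
Proof.
pose W l := (\sum_k dxS k (e l) * yS k) - dxS l ES.
have WE : W l = \sum_k yS k * dxS k (e l) - dxS l ES.
  by congr (_ - _); apply: eq_bigr => k _; rewrite mulrC.
rewrite -WE mulr_sumr.
rewrite (eq_bigr (fun i => \sum_r (2 * half) * (2 * half) * W r * (ee l i * a i r))).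
  rewrite exchange_big /= -[RHS](sum_deltal l); apply: eq_bigr => r _.
  by rewrite -mulr_sumr eeaV half2; ring.
move=> i _; rewrite /GS mulr_sumr mulr_suml mulr_sumr; apply: eq_bigr => r _.
by rewrite (dyS_comm i l) /W; ring.
Qed.

Local Notation N i k := (dyS k (GS i)).
Local Notation X := (spray_der dxS dyS yS GS).

Let spray_derE_S := spray_derE dxS_der dyS_der dyS_comm dyxS_comm dxS_y dyS_y
  S_nat_cancel eeaV euler_ES spray_eq_GS.

Lemma represents_N i k : represents (partial_y k (spray F i)) (N i k).
Proof. exact: represents_partial_y (represents_spray i). Qed.

Lemma represents_berwald i j k l :
  represents (berwald F i j k l) (dyS j (dyS k (N i l))).
Proof. exact/represents_partial_y/represents_partial_y/represents_N. Qed.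

Lemma represents_cartan i j k :
  represents (cartan F i j k) (half * half * eee k i j).
Proof.
have -> : half * half * eee k i j = half * dyS k (half * ee i j).
  rewrite (derM (dyS_der k)); have -> : dyS k half = 0; last by ring.
  have := congr1 (dyS k) half2; rewrite (der_natM (dyS_der k)) (der1 (dyS_der k)).
  by move=> H2; apply: (@S_nat_cancel 1); rewrite mulr0.
apply: (representsM represents_half).
exact: represents_partial_y (represents_fund i j).
Qed.

Lemma represents_mean_cartan k :
  represents (mean_cartan F k) (half * \sum_i \sum_j a i j * eee i j k).
Proof.
have -> : half * \sum_i \sum_j a i j * eee i j k =
    \sum_i \sum_j (2 * a i j) * (half * half * eee k i j).
  rewrite mulr_sumr; apply: eq_bigr => i _; rewrite mulr_sumr.
  apply: eq_bigr => j _; rewrite (dyS_comm k) (dyS_comm k).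
  transitivity ((2 * half) * half * (a i j * eee i j k)); last by ring.
  by rewrite half2 mul1r.
apply: represents_sum => i; apply: represents_sum => j.
apply: representsM; [exact: represents_inv_fund | exact: represents_cartan].
Qed.

Lemma represents_hderiv f (phi : S) : represents f phi ->
  represents (hderiv_along F f) (X phi).
Proof.
move=> fphi.
rewrite spray_derE_S.
apply: represents_sum => s; apply: representsM; last by move=> q Dq; rewrite yS_val.
apply: (@representsD _ _ _ _ _ (fun p => - \sum_m partial_y s (spray F m) p * partial_y m f p)).
  exact: represents_partial_x.
apply: representsN; apply: represents_sum => m; apply: representsM.
  exact: represents_N.
exact: represents_partial_y.
Qed.

Lemma represents_riemann i k :
  represents (riemann F i k) (riem dxS dyS yS GS i k).
Proof.
rewrite riemE.
apply: (@representsD _ _ _ _ (fun p => 2 * partial_x k (spray F i) p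
  - \sum_j p.2 0 j * partial_x j (partial_y k (spray F i)) p
  + 2 * \sum_j spray F j p * partial_y j (partial_y k (spray F i)) p)
  (fun p => - \sum_j partial_y j (spray F i) p * partial_y k (spray F j) p)); last first.
  apply: representsN; apply: represents_sum => j.
  by apply: representsM; exact: represents_N.
apply: (@representsD _ _ _ _ (fun p => 2 * partial_x k (spray F i) p
  - \sum_j p.2 0 j * partial_x j (partial_y k (spray F i)) p)
  (fun p => 2 * \sum_j spray F j p * partial_y j (partial_y k (spray F i)) p));
  last first.
  apply: (representsM (represents_nat _ 2)); apply: represents_sum => j.
  apply: representsM; first exact: represents_spray.
  exact/represents_partial_y/represents_N.
apply: (@representsD _ _ _ _ (fun p => 2 * partial_x k (spray F i) p)
  (fun p => - \sum_j p.2 0 j * partial_x j (partial_y k (spray F i)) p)).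
  apply: (representsM (represents_nat _ 2)).
  exact/represents_partial_x/represents_spray.
apply: representsN; apply: represents_sum => j; apply: representsM.
  by move=> q Dq; rewrite yS_val.
exact/represents_partial_x/represents_N.
Qed.


Let hessian_yS := hessian_y dyS_der dyS_comm dyS_y euler_ES.

Lemma represents_y_low i : represents (y_low F i) (half * e i).
Proof.
have -> : half * e i = \sum_j half * ee i j * yS j.
  rewrite -hessian_yS mulr_sumr; apply: eq_bigr => j _.
  by rewrite (dyS_comm i); ring.
apply: represents_sum => j; apply: representsM; first exact: represents_fund.
by move=> q Dq; rewrite yS_val.
Qed.

Lemma fund_form p : fund_product F p =2 form (fund_tensor F p).
Proof. by move=> u v; rewrite formE. Qed.

Lemma fund_sym p : D p -> (fund_tensor F p)^T = fund_tensor F p.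
Proof.
move=> Dp; apply/matrixP => i j; rewrite mxE.
rewrite (represents_fund j i Dp) (represents_fund i j Dp).
by rewrite (dyS_comm i).
Qed.

Lemma y_low_row p i : D p -> (p.2 *m fund_tensor F p) 0 i = y_low F i p.
Proof.
move=> Dp; rewrite mxE /y_low; apply: eq_bigr => j _.
by rewrite -[in LHS](fund_sym Dp) mxE mulrC.
Qed.

Lemma sum_y_low p : D p -> \sum_i p.2 0 i * y_low F i p = F p ^+ 2.
Proof.
move=> Dp; apply: etrans _ (esym (ES_represents Dp)).
have <- : \sum_i yS i * (half * e i) = ES.
  rewrite (eq_bigr (fun i => half * (yS i * e i))); last by move=> i _; ring.
  rewrite -mulr_sumr euler_ES mulrA (mulrC half) half2; ring.
apply: (@represents_sum _ _ _ _ _ (fun i p => p.2 0 i * y_low F i p)) Dp => i.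
by apply: representsM; [move=> q Dq; rewrite yS_val | exact: represents_y_low].
Qed.

Lemma fund_yy p : D p -> form (fund_tensor F p) p.2 p.2 = F p ^+ 2.
Proof.
move=> Dp; rewrite -sum_y_low// /form mxE; apply: eq_bigr => i _.
by rewrite y_low_row// mxE mulrC.
Qed.

Lemma F_gt0 p : D p -> 0 < F p.
Proof.
move=> Dp; rewrite lt_def F_ge0// andbT -sqrf_eq0 -fund_yy//.
by rewrite gt_eqF// -fund_form F_posdef// D_slit.
Qed.

Lemma ES_val p : D p -> ES p = F p ^+ 2.
Proof. by move=> Dp; rewrite -(ES_represents Dp). Qed.

Lemma ES_neq0 p : D p -> ES p != 0.
Proof. by move=> Dp; rewrite ES_val// sqrf_eq0 gt_eqF// F_gt0. Qed.

Lemma ES_cancel (f g : S) : ES * f = ES * g -> f = g.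
Proof.
move=> fg; apply: smooth_fun_ext => p Dp.
have fgp : (ES * f : S) p = (ES * g : S) p by rewrite fg.
rewrite (smooth_funM ES f) (smooth_funM ES g) in fgp.
by apply: (mulfI (ES_neq0 Dp)); exact: fgp.
Qed.

Lemma spray_der_FS : X FS = 0.
Proof.
apply: smooth_fun_ext => p Dp.
have := spray_der_E dxS_der dyS_der dxS_y dyS_y euler_ES spray_eq_GS.
rewrite /ES (derM (spray_derP _ _ dxS_der dyS_der)) => EX.
have : (X FS * FS + FS * X FS : S) p = 0 by rewrite EX.
rewrite smooth_funD !smooth_funM -(FS_represents Dp) mulrC -mulr2n.
move/eqP; rewrite mulrn_eq0 mulf_eq0 /= (gt_eqF (F_gt0 Dp)) /= => /eqP ->.
reflexivity.
Qed.

Section IsotropicBerwald.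
Variables mu lambda : V -> R.
Hypothesis mu_smooth : smooth_on D mu.
Hypothesis F_isotropic : forall p, D p -> forall i j k l,
  berwald F i j k l p = mu p * cartan F j k l p * ell F i p
    + lambda p * (angular_mixed F i j p * angular_low F k l p
                  + angular_mixed F i k p * angular_low F j l p
                  + angular_mixed F i l p * angular_low F j k p).

Definition muS : S := to_smooth Dop mu_smooth.
Definition psiS : S := half * muS * FS.

(** Contracting with [y_s] kills the angular tensors [h^s_j], and turns [l^s]
    into [F]. *)
Lemma landsberg_isotropic j k l :
  landsberg dyS GS ES j k l = psiS * eee j k l.
Proof.
apply: smooth_fun_ext => p Dp.
have F0 : F p != 0 by rewrite gt_eqF// F_gt0.
have eE s : (e s : S) p = 2 * y_low F s p.
  rewrite (represents_y_low s Dp) smooth_funM -(represents_half Dp).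
  by rewrite mulrA mulfV ?mul1r// pnatr_eq0.
have ang j' : \sum_s y_low F s p * angular_mixed F s j' p = 0.
  rewrite (eq_bigr (fun s => (j' == s)%:R * y_low F s p
      - (F p)^-2 * y_low F j' p * (p.2 0 s * y_low F s p))); last first.
    by move=> s _; rewrite /angular_mixed (eq_sym j'); ring.
  by rewrite sumrB sum_deltal -mulr_sumr sum_y_low//; field.
have LE : (landsberg dyS GS ES j k l : S) p =
    \sum_s 2 * y_low F s p * berwald F s j k l p.
  apply: esym.
  apply: (@represents_sum _ _ _ _ _ (fun s p => 2 * y_low F s p * berwald F s j k l p)) Dp.
  move=> s; apply: representsM; last exact: represents_berwald.
  have -> : e s = 2 * (half * e s) by rewrite mulrA half2 mul1r.
  apply: (representsM (represents_nat _ 2)); exact: represents_y_low.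
have CE : cartan F j k l p = 2^-1 * 2^-1 * (eee j k l : S) p.
  rewrite (represents_cartan j k l Dp) !smooth_funM -(represents_half Dp).
  by rewrite (dyS_comm l) (dyS_comm l).
have RE : (psiS * eee j k l : S) p = 2^-1 * mu p * F p * (eee j k l : S) p.
  rewrite !smooth_funM -(represents_half Dp) -(FS_represents Dp).
  by rewrite (to_smoothE Dop mu_smooth Dp).
rewrite {}LE {}RE; move: CE; move: ((eee j k l : S) p) => c CE.
rewrite (eq_bigr (fun s =>
   2 * mu p * cartan F j k l p * (F p)^-1 * (p.2 0 s * y_low F s p)
   + 2 * lambda p * angular_low F k l p * (y_low F s p * angular_mixed F s j p)
   + 2 * lambda p * angular_low F j l p * (y_low F s p * angular_mixed F s k p)
   + 2 * lambda p * angular_low F j k p * (y_low F s p * angular_mixed F s l p)));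
  last first.
  by move=> s _; rewrite F_isotropic// /ell; ring.
rewrite !big_split /= -!mulr_sumr !ang sum_y_low// CE !mulr0 !addr0.
by field.
Qed.

Section ScalarFlag.
Variable K : V -> R.
Hypothesis n_gt1 : (1 < n)%N.
Hypothesis F_flag : forall p (u : 'rV[R]_n), D p -> free [:: p.2; u] ->
  flag_curvature F p u = K p.

Local Notation riemS := (riem dxS dyS yS GS).
Local Notation lowS := (riem_low dxS dyS yS GS ES).

(** The flags with flagpole [y] determine the quadratic form of [R] on the vectors
    independent of [y], hence everywhere; as [R] is self-adjoint, they determine
    [R]. *)
Lemma scalar_pointwise p k l : D p ->
  2 * (lowS k l : S) p = K p * (2 * ES p * (ee k l : S) p - (e k : S) p * (e l : S) p).
Proof.
move=> Dp; pose g := fund_tensor F p; pose y := p.2.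
pose Rm : 'M[R]_n := \matrix_(i, j) riemann F i j p.
pose w := y *m g.
have lowE i j : (g *m Rm) i j = 2^-1 * (lowS j i : S) p.
  have -> : (lowS j i : S) = 2 * \sum_r half * ee i r * riemS r j.
    rewrite mulr_sumr; apply: eq_bigr => r _.
    transitivity ((2 * half) * (riemS r j * ee r i)); first by rewrite half2 mul1r.
    by rewrite (dyS_comm i); ring.
  rewrite smooth_funM smooth_nat// mulrA mulVf ?mul1r ?pnatr_eq0//.
  rewrite mxE.
  have H : represents (fun q => \sum_r fund_tensor F q i r * riemann F r j q)
      (\sum_r half * ee i r * riemS r j).
    apply: represents_sum => r; apply: representsM; first exact: represents_fund.
    exact: represents_riemann.
  by rewrite -(H p Dp); apply: eq_bigr => r _; rewrite [Rm _ _]mxE.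
have wE i : w 0 i = 2^-1 * (e i : S) p.
  by rewrite /w y_low_row// (represents_y_low i Dp) smooth_funM -(represents_half Dp).
have gE i j : g i j = 2^-1 * (ee i j : S) p.
  by rewrite (represents_fund i j Dp) smooth_funM -(represents_half Dp).
have gT : g^T = g by exact: fund_sym.
pose s := g *m Rm - K p *: (F p ^+ 2 *: g - w^T *m w).
have symlow := riem_low_sym dxS_der dyS_der dxS_comm dyS_comm dyxS_comm dxS_y dyS_y
  S_nat_cancel spray_eq_GS.
have sE i j :
    s i j = (g *m Rm) i j - K p * (F p ^+ 2 * g i j - w 0 i * w 0 j).
  rewrite /s [LHS]mxE; congr (_ + _).
  rewrite [LHS]mxE [in LHS]mxE; congr (- (_ * _)).
  rewrite [LHS]mxE; congr (_ + _); first by rewrite [LHS]mxE.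
  by rewrite [LHS]mxE [in LHS]mxE big_ord1 [w^T _ _]mxE.
have sT : s^T = s.
  have gC i j : g j i = g i j by rewrite -[in LHS]gT mxE.
  have lowC i j : (g *m Rm) j i = (g *m Rm) i j.
    by rewrite (lowE j i) (lowE i j) (symlow i j).
  apply/matrixP => i j; rewrite [LHS]mxE (sE j i) (sE i j) gC lowC.
  by rewrite (mulrC (w 0 j)).
have formw u : form (w^T *m w) u u = form g y u ^+ 2.
  rewrite /form mulmxA -mulmxA mxE big_ord1.
  rewrite -[u *m w^T]trmxK trmx_mul trmxK -/w mxE expr2; reflexivity.
have s0 : s = 0.
  apply: (form_eq0_of_free n_gt1 (D_slit Dp) sT) => u yu.
  have formR : form (g *m Rm) u u = fund_product F p u (riemann_map F p u).
    rewrite fund_form /form; congr (fun_of_matrix _ 0 0); rewrite -!mulmxA.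
    congr (_ *m (_ *m _)); apply/matrixP => i j; rewrite !mxE.
    by apply: eq_bigr => r _; rewrite !mxE (ord1 j).
  have gpos v : v != 0 -> 0 < form g v v.
    by move=> v0; rewrite -fund_form; exact: F_posdef.
  have den := cauchy_schwarz_strict gT gpos yu.
  have := F_flag Dp yu; rewrite /flag_curvature -formR !fund_form.
  move=> /(canRL (divfK (lt0r_neq0 den))) num.
  rewrite /s formBm formZm formBm formZm formw num fund_yy//; ring.
have slk : s l k = 0 by rewrite s0 mxE.
have slk' := sE l k.
rewrite slk lowE gE (wE l) (wE k) -(ES_val Dp) (dyS_comm l k) in slk'.
have solve (t E' c x z m : R) :
  0 = 2^-1 * t - m * (E' * (2^-1 * c) - 2^-1 * x * (2^-1 * z)) ->
  2 * t = m * (2 * E' * c - z * x).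
  by move=> H; apply: (eq_of_diff (congr1 (fun r => - 4 * r) H)); field.
exact: solve slk'.
Qed.

(** The trace of the Riemann curvature is [(n - 1) K F ^ 2]. *)
Lemma flag_curvature_smooth : exists KS : S, represents K KS.
Proof.
have [Ei EEi] : exists d : S, ES * d = 1.
  by apply: smooth_inverse => p Dp; exact: ES_neq0.
pose tr : S := \sum_k \sum_l a k l * lowS k l.
exists (smooth_cst Dop (n%:R - 1)^-1 * (Ei * tr)) => p Dp.
have n1 : n%:R - 1 != 0 :> R by rewrite subr_eq0 pnatr_eq1 gtn_eqF.
pose qd k l := 2 * ES * ee k l - e k * e l.
have trE : 2 * tr p = K p * (2 * ES p * (n%:R - 1)).
  have qE : (\sum_k \sum_l a k l * qd k l : S) p = 2 * ES p * (n%:R - 1).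
    have := trace_quad dyS_der dyS_comm dyS_y aeeV euler_ES.
    rewrite -[\sum_k \sum_l a k l * quad _ _ _ _]/(\sum_k \sum_l a k l * qd k l) => ->.
    rewrite (smooth_funM (2 * ES)) (smooth_funM 2) (smooth_funD n%:R) smooth_funN.
    by rewrite !(smooth_nat _ Dp) (smooth_nat 1 Dp).
  have evs (f : 'I_n -> 'I_n -> S) :
      (\sum_k \sum_l f k l : S) p = \sum_k \sum_l (f k l : S) p.
    rewrite -[LHS]/(smooth_eval Dp _) rmorph_sum; apply: eq_bigr => k _.
    by rewrite rmorph_sum.
  rewrite -qE /tr !evs !mulr_sumr; apply: eq_bigr => k _.
  rewrite !mulr_sumr; apply: eq_bigr => l _.
  rewrite !(smooth_funM (a k l)) mulrCA scalar_pointwise//.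
  have -> : qd k l p = 2 * ES p * (ee k l : S) p - (e k : S) p * (e l : S) p.
    rewrite smooth_funD smooth_funN (smooth_funM (2 * ES)) (smooth_funM 2).
    by rewrite (smooth_funM (e k)) smooth_nat.
  by rewrite mulrCA.
have EiE : Ei p = (ES p)^-1.
  apply: (mulfI (ES_neq0 Dp)); rewrite mulfV ?ES_neq0//.
  by rewrite -(smooth_funM ES) EEi; exact: (smooth_nat 1 Dp).
rewrite (smooth_funM (smooth_cst _ _)) (smooth_funM Ei) EiE -(represents_cst _ _ Dp).
have := ES_neq0 Dp; move: trE n1; move: (tr p) (ES p) (K p) => t E' k trE n1 E0.
have -> : t = k * E' * (n%:R - 1).
  by apply: (@mulfI _ 2); rewrite ?pnatr_eq0// trE; ring.
by field; rewrite E0 n1.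
Qed.

(** This is contracted_identity evaluated at [p], divided by [6 F^2]. There
    [E = F^2], the trace of the third derivatives is twice the mean Cartan
    torsion, and [X psi = mu' F / 2] as [X F = 0]. *)
Lemma local_identity p k : D p ->
  (n%:R + 1) / 3 * partial_y k K p
  + (K p + mu p ^+ 2 / 4 - hderiv_along F mu p / (2 * F p))
    * mean_cartan F k p = 0.
Proof.
move=> Dp; have [KS KSK] := flag_curvature_smooth.
have scal i l : 2 * lowS i l = KS * (2 * ES * ee i l - e i * e l).
  apply: smooth_fun_ext => q Dq.
  rewrite (smooth_funM 2) (smooth_funM KS) smooth_nat// scalar_pointwise//.
  rewrite -(KSK q Dq) smooth_funD smooth_funN (smooth_funM (2 * ES)) (smooth_funM 2).
  by rewrite (smooth_funM (e i)) smooth_nat.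
have := contracted_identity dxS_der dyS_der dyS_comm dyxS_comm dxS_y dyS_y
  S_nat_cancel eeaV aeeV euler_ES spray_eq_GS scal landsberg_isotropic ES_cancel n_gt1 k.
set c : S := \sum_i \sum_j _.
have XP := spray_derP yS GS dxS_der dyS_der.
have Xhalf : X half = 0.
  by apply: (@S_nat_cancel 1); rewrite mulr0 -(der_natM XP) half2 (der1 XP).
have -> : X psiS = half * X muS * FS.
  by rewrite /psiS (derM XP (half * muS)) (derM XP half) Xhalf spray_der_FS; ring.
set phi := (X in X = 0 -> _) => phi0.
have : phi p = 0 by rewrite phi0.
have I2 : mean_cartan F k p = 2^-1 * c p.
  by rewrite (represents_mean_cartan k Dp) (smooth_funM half) -(represents_half Dp).
have mE : muS p = mu p by exact: to_smoothE.
have Xm : (X muS : S) p = hderiv_along F mu p.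
  by apply/esym/represents_hderiv => //; exact: represents_to_smooth.
have Ky : (dyS k KS : S) p = partial_y k K p.
  by apply/esym/represents_partial_y.
have F0 : F p != 0 by rewrite gt_eqF// F_gt0.
have -> : phi p = 3 * ((2^-1 * mu p * F p) ^+ 2 + K p * F p ^+ 2
    - 2^-1 * hderiv_along F mu p * F p) * c p
    + 2 * F p ^+ 2 * (n%:R + 1) * partial_y k K p.
  rewrite /phi smooth_funD (smooth_funM _ c) (smooth_funM 3) (smooth_nat 3 Dp).
  rewrite (smooth_funD (_ + _)) smooth_funN (smooth_funD _ (KS * ES)).
  rewrite expr2 (smooth_funM psiS) (smooth_funM KS ES).
  rewrite (smooth_funM (half * X muS)) (smooth_funM half (X muS)).
  rewrite (smooth_funM (half * muS)) (smooth_funM half muS).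
  rewrite (smooth_funM (2 * ES * (n%:R + 1))) (smooth_funM (2 * ES)) (smooth_funM 2 ES).
  rewrite (smooth_nat 2 Dp) (smooth_funD n%:R) (smooth_nat n Dp) (smooth_nat 1 Dp).
  rewrite Xm Ky mE -(KSK p Dp) ES_val//.
  by rewrite -(FS_represents Dp) -(represents_half Dp) -expr2.
rewrite I2; move: (c p) (hderiv_along F mu p) (partial_y k K p) (mu p) (K p) => c' m' K' m K0.
move: F0; move: (F p) => F' F0 H.
(* The identity H is [6 F^2] times the goal. *)
apply: (eq_of_diff (congr1 (fun t => (6 * F' ^+ 2)^-1 * t) H)).
by field.
Qed.

End ScalarFlag.
End IsotropicBerwald.
End Inverse.
End Bridge.

(** * From a chart to the manifold *)

Lemma slit_chart_open (R : realType) (n : nat) (M : smooth_manifold R n)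
  (a : atlas M) : open (slit_chart a).
Proof.
have -> : slit_chart a = (fst @^-1` chart_image a) `&`
    (snd @^-1` [set y : 'rV[R]_n | y != 0]) by [].
apply: openI; apply: open_comp.
- by move=> p _; exact: cvg_fst.
- exact: chart_image_open.
- by move=> p _; exact: cvg_snd.
- rewrite (_ : [set y | y != 0] = ~` [set (0 : 'rV[R]_n)]).
    by apply: closed_openC; apply: accessible_closed_set1; exact: hausdorff_accessible.
  by apply/seteqP; split=> y /=; [move/eqP | move=> /eqP].
Qed.

Theorem theorem1p4 (R : realType) (n : nat) (M : smooth_manifold R n)
    (F mu lambda K : tangent_bundle M -> R)
    (hn : (1 < n)%N)
    (hF : finsler_metric F)
    (hB : generalized_isotropic_berwald F mu lambda)
    (hK : scalar_flag_curvature F K)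
    (a : atlas M) (p : 'rV[R]_n * 'rV[R]_n) (hp : slit_chart a p) (k : 'I_n) :
  (n%:R + 1) / 3 * partial_y k (local_rep K a) p
  + (local_rep K a p + local_rep mu a p ^+ 2 / 4
     - hderiv_along (local_rep F a) (local_rep mu a) p
       / (2 * local_rep F a p))
    * mean_cartan (local_rep F a) k p = 0.
Proof.
have Dop : open (slit_chart a) by exact: slit_chart_open.
have D_slit q : slit_chart a q -> q.2 != 0 by case.
have F_ge0 q : slit_chart a q -> 0 <= local_rep F a q.
  by move=> _; exact: finsler_ge0 hF _.
have F_smooth : smooth_on (slit_chart a) (local_rep F a).
  exact: finsler_smooth.
have F_homogeneous q (t : R) : slit_chart a q -> 0 < t ->
    local_rep F a (q.1, t *: q.2) = t * local_rep F a q.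
  case: q => x y [ax _] t0; exact: (finsler_homogeneous hF).
have F_posdef q (u : 'rV[R]_n) : slit_chart a q -> u != 0 ->
    0 < fund_product (local_rep F a) q u u .
  exact: finsler_posdef.
have [g [gaV agV]] := hessian_inverse Dop F_smooth F_posdef.
have F_berwald q (Dq : slit_chart a q) := gib_berwald hB Dq.
have F_flag q (u : 'rV[R]_n) : slit_chart a q -> free [:: q.2; u] ->
    flag_curvature (local_rep F a) q u = local_rep K a q by exact: hK.
exact: (local_identity (Dop := Dop) D_slit F_ge0 F_homogeneous F_posdef gaV agV
  (gib_smooth_mu hB a) F_berwald hn F_flag k hp).
Qed.
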